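(* Let $M$ be an $n$-dimensional closed Riemannian manifold whose Ricci curvature satisfies $\mathrm{Ric}(M)\ge (n-1)\kappa$ for some constant $\kappa<0$. Let $\lambda$ be the first non-zero eigenvalue of the Laplacian $\Delta$ of $M$, let $v$ be an eigenfunction for $\lambda$ (so $\Delta v=-\lambda v$, $v\not\equiv 0$), and let $\tilde d$ be the diameter of the largest interior ball in the nodal domains of $v$. Then $$\lambda \ \ge\ \frac{1}{1-(n-1)\kappa/(2\lambda)}\,\frac{\pi^2}{\tilde d^{\,2}}\ >\ 0,$$ and $\lambda$ has the lower bound $$\lambda \ \ge\ \frac12 (n-1)\kappa+\frac{\pi^2}{\tilde d^{\,2}}.$$
   Context: Closed means compact, connected and without boundary. The Laplacian $\Delta$ is the Laplace–Beltrami operator with the sign convention that eigenvalues $\lambda\ge 0$ satisfy $\Delta v=-\lambda v$. The condition $\mathrm{Ric}(M)\ge (n-1)\kappa$ means $\mathrm{Ric}(X,X)\ge (n-1)\kappa |X|^2$ for all tangent vectors $X$. An eigenfunction $v$ of the first non-zero eigenvalue has exactly two nodal domains $D^+=\{x\in M: v(x)>0\}$ and $D^-=\{x\in M: v(x)<0\}$. Put $r_\pm=\max_{x\in D^\pm}\mathrm{dist}(x,v^{-1}(0))$ and $d_\pm=2r_\pm$, where $\mathrm{dist}$ is Riemannian distance. The diameter of the largest interior ball in the nodal domains is $\tilde d=\max\{d_+,d_-\}$. *)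

(* Defs.v *)
From HB Require Import structures.
From mathcomp Require Import all_boot all_order all_algebra.
From mathcomp Require Import all_classical all_reals all_analysis.

Set Implicit Arguments.
Unset Strict Implicit.
Unset Printing Implicit Defensive.

Import Order.TTheory GRing.Theory Num.Theory.
Import numFieldNormedType.Exports.

Local Open Scope classical_set_scope.
Local Open Scope ring_scope.

Definition partial (R : realType) (n : nat) (i : 'I_n)
    (f : 'rV[R]_n -> R) (x : 'rV[R]_n) : R :=
  'D_('e_i) f x.

(* Meant for open [U], on which partial derivatives only depend on the values
   of [f] on [U]. *)
Fixpoint Ck_on (R : realType) (n k : nat) (U : set 'rV[R]_n)
    (f : 'rV[R]_n -> R) : Prop :=
  (forall x, U x -> {for x, continuous f}) /\
  match k with
  | 0 => True
  | k'.+1 => forall i : 'I_n,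
      (forall x, U x -> derivable f x 'e_i) /\ Ck_on k' U (partial i f)
  end.

Definition smooth_on (R : realType) (n : nat) (U : set 'rV[R]_n)
    (f : 'rV[R]_n -> R) : Prop :=
  forall k : nat, Ck_on k U f.

(* A homeomorphism from the open set [chart_dom] of [M] onto the open set
   [chart_cod] of R^n; [coord] and [param] are total maps of which only the
   restrictions to these sets matter. *)
Record chart (R : realType) (n : nat) (M : topologicalType) : Type := Chart {
  chart_dom : set M;
  chart_cod : set 'rV[R]_n;
  coord : M -> 'rV[R]_n;
  param : 'rV[R]_n -> M;
  chart_dom_open : open chart_dom;
  chart_cod_open : open chart_cod;
  coord_cod : forall p, chart_dom p -> chart_cod (coord p);
  param_dom : forall x, chart_cod x -> chart_dom (param x);
  coordK : forall p, chart_dom p -> param (coord p) = p;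
  paramK : forall x, chart_cod x -> coord (param x) = x;
  coord_continuous : forall p, chart_dom p -> {for p, continuous coord};
  param_continuous : forall x, chart_cod x -> {for x, continuous param}
}.

Definition transition (R : realType) (n : nat) (M : topologicalType)
    (c d : chart R n M) (x : 'rV[R]_n) : 'rV[R]_n :=
  coord d (param c x).

Definition overlap (R : realType) (n : nat) (M : topologicalType)
    (c d : chart R n M) : set 'rV[R]_n :=
  [set x | chart_cod c x /\ chart_dom d (param c x)].

Definition transition_jacobian (R : realType) (n : nat) (M : topologicalType)
    (c d : chart R n M) (x : 'rV[R]_n) : 'M[R]_n :=
  \matrix_(a, i) partial i (fun y => transition c d y 0 a) x.

Definition quad (R : realType) (n : nat) (A : 'M[R]_n) (X : 'rV[R]_n) : R :=
  (X *m A *m X^T) 0 0.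

(* A smooth manifold without boundary modelled on R^n, with a smooth
   Riemannian metric. The metric is given by its component matrices in the
   charts of the atlas, [rm_metric c x] being the matrix (g_ij) at the point
   with coordinates [x] in the chart [c]. The atlas need not be maximal. *)
Record riemannian_manifold (R : realType) (n : nat) : Type :=
    RiemannianManifold {
  rm_space :> topologicalType;
  rm_atlas : set (chart R n rm_space);
  rm_metric : chart R n rm_space -> 'rV[R]_n -> 'M[R]_n;
  rm_hausdorff : hausdorff_space rm_space;
  rm_second_countable : @second_countable rm_space;
  rm_cover : forall p : rm_space, exists2 c, rm_atlas c & chart_dom c p;
  rm_compatible : forall c d, rm_atlas c -> rm_atlas d ->
    forall a : 'I_n, smooth_on (overlap c d) (fun x => transition c d x 0 a);
  rm_metric_smooth : forall c, rm_atlas c ->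
    forall i j : 'I_n, smooth_on (chart_cod c) (fun x => rm_metric c x i j);
  rm_metric_sym : forall c x, rm_atlas c -> chart_cod c x ->
    (rm_metric c x)^T = rm_metric c x;
  rm_metric_posdef : forall c x, rm_atlas c -> chart_cod c x ->
    forall X : 'rV[R]_n, X != 0 -> 0 < quad (rm_metric c x) X;
  rm_metric_tensor : forall c d x, rm_atlas c -> rm_atlas d ->
    overlap c d x ->
    rm_metric c x =
      (transition_jacobian c d x)^T *m rm_metric d (transition c d x)
        *m transition_jacobian c d x
}.

Definition closed_manifold (R : realType) (n : nat)
    (M : riemannian_manifold R n) : Prop :=
  compact [set: M] /\ connected [set: M].

Section Coordinates.
Variables (R : realType) (n : nat).
Variable G : 'rV[R]_n -> 'M[R]_n.

Definition christoffel (k i j : 'I_n) (x : 'rV[R]_n) : R :=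
  2^-1 * \sum_l invmx (G x) k l *
    (partial i (fun y => G y j l) x + partial j (fun y => G y i l) x
       - partial l (fun y => G y i j) x).

(* R(d_i, d_j) d_k = \sum_l (riemann l k i j) d_l *)
Definition riemann (l k i j : 'I_n) (x : 'rV[R]_n) : R :=
  partial i (christoffel l j k) x - partial j (christoffel l i k) x
  + \sum_m (christoffel l i m x * christoffel m j k x
            - christoffel l j m x * christoffel m i k x).

(* Ric(Y, Z) is the trace of X |-> R(X, Y) Z, so that round spheres have
   positive Ricci curvature. *)
Definition ricci (x : 'rV[R]_n) : 'M[R]_n :=
  \matrix_(j, k) \sum_i riemann i k i j x.

Definition hessian (f : 'rV[R]_n -> R) (x : 'rV[R]_n) : 'M[R]_n :=
  \matrix_(i, j) (partial i (partial j f) x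
                  - \sum_k christoffel k i j x * partial k f x).

(* The trace of the covariant Hessian with respect to the metric, that is,
   the divergence of the gradient. *)
Definition laplacian (f : 'rV[R]_n -> R) (x : 'rV[R]_n) : R :=
  \sum_i \sum_j invmx (G x) i j * hessian f x i j.

End Coordinates.

Section Geometry.
Variables (R : realType) (n : nat) (M : riemannian_manifold R n).

(* Tangent vectors are represented by their components in a chart. *)
Definition ricci_ge (K : R) : Prop :=
  forall c x, rm_atlas c -> chart_cod c x -> forall X : 'rV[R]_n,
    K * quad (@rm_metric R n M c x) X <= quad (ricci (rm_metric c) x) X.

Definition smooth_function (v : M -> R) : Prop :=
  forall c, rm_atlas c -> smooth_on (chart_cod c) (v \o param c).

(* Delta v = w *)
Definition laplace_beltrami_eq (v w : M -> R) : Prop :=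
  forall c x, rm_atlas c -> chart_cod c x ->
    laplacian (rm_metric c) (v \o param c) x = w (param c x).

Definition eigenfunction (lambda : R) (v : M -> R) : Prop :=
  [/\ smooth_function v,
      exists p, v p != 0
    & laplace_beltrami_eq v (fun p => - lambda * v p)].

Definition eigenvalue (lambda : R) : Prop :=
  exists v, eigenfunction lambda v.

Definition first_nonzero_eigenvalue (lambda : R) : Prop :=
  [/\ eigenvalue lambda,
      lambda != 0
    & forall mu, eigenvalue mu -> mu != 0 -> lambda <= mu].

(* C^1 up to the end points of [0, 1], two-sided derivatives there amounting
   to the choice of a C^1 extension. *)
Definition C1_arc (gamma : R -> 'rV[R]_n) : Prop :=
  (forall t, 0 <= t <= 1 -> derivable gamma t 1) /\
  {within `[0, 1], continuous (derive1 gamma)}.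

Definition arc_length (c : chart R n M) (gamma : R -> 'rV[R]_n) : R :=
  Rintegral lebesgue_measure `[0, 1]
    (fun t => Num.sqrt (quad (rm_metric c (gamma t)) (derive1 gamma t))).

(* [joined p q L]: some piecewise C^1 curve from [p] to [q] has length [L].
   By compactness of the parameter interval, such a curve is a finite
   concatenation of C^1 arcs each lying in a single chart domain. *)
Inductive joined : M -> M -> R -> Prop :=
| joined_refl p : joined p p 0
| joined_arc c gamma q L :
    rm_atlas c -> C1_arc gamma ->
    (forall t, 0 <= t <= 1 -> chart_cod c (gamma t)) ->
    joined (param c (gamma 1)) q L ->
    joined (param c (gamma 0)) q (arc_length c gamma + L).

Definition rdist (p q : M) : R := inf [set L | joined p q L].

Definition rdist_set (p : M) (S : set M) : R := inf [set rdist p q | q in S].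

Definition nodal_set (v : M -> R) : set M := [set p | v p = 0].
Definition nodal_pos (v : M -> R) : set M := [set p | 0 < v p].
Definition nodal_neg (v : M -> R) : set M := [set p | v p < 0].

(* On a closed manifold the supremum is a maximum, the distance to
   [nodal_set v] being continuous and zero on the boundary of [D]. *)
Definition inradius (v : M -> R) (D : set M) : R :=
  sup [set rdist_set p (nodal_set v) | p in D].

Definition largest_interior_diameter (v : M -> R) : R :=
  Num.max (2 * inradius v (nodal_pos v)) (2 * inradius v (nodal_neg v)).

End Geometry.

(* Main.v *)
(* Put K = (n-1)kappa <= 0, a^2 = -K/2 and m^2 = lambda + a^2. On
   |s| < pi/(2m) the function w with w' = cos(as) cos(ms) and w(0) = 0 is
   increasing and solves w'' - T w' + lambda w = 0 with T = -2a tan(as), where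
   T' = K - T^2/2 <= K. Scale the eigenfunction so that max |v| = w(s0) with
   s0 < pi/(2m). The maximum principle and the Bochner formula, whose Hessian
   term is bounded below by its part along dv, give
   |grad v| <= w'(w^-1(v)) on M, that is, w^-1 o v is 1-Lipschitz. It equals s0
   up to sign at a maximum point p of |v| and vanishes on the nodal set, so p is
   at distance at least s0 from the nodal set. Letting s0 tend to pi/(2m), the
   largest interior diameter is at least pi/m, which is the second inequality;
   the first one is equivalent to it. *)
Require Import Defs.
From HB Require Import structures.
From mathcomp Require Import all_boot all_order all_algebra.
From mathcomp Require Import all_classical all_reals all_analysis.
From mathcomp Require Import ring lra.

Set Implicit Arguments.
Unset Strict Implicit.
Unset Printing Implicit Defensive.

Import Order.TTheory GRing.Theory Num.Theory.
Import numFieldNormedType.Exports.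

Local Open Scope classical_set_scope.
Local Open Scope ring_scope.

(** * Calculus on R^n *)

(** Origin of T: at a point where the gradient bound is attained, the Bochner formula leaves w''^2 -
    w' w''' + (K - lambda) w'^2 + lambda w w''. If w'' - T w' + lambda w = 0, this equals (K - T')
    w'^2, which is nonnegative as soon as T' <= K. Differentiating the equation and writing w' =
    exp(int T/2) z removes the first-order term and leaves z'' + (lambda - T'/2 - T^2/4) z = 0. The
    choice T' = K - T^2/2 makes this potential the constant lambda - K/2 = m^2; then exp(int T/2) =
    cos(as) and z = cos(ms). This is where the factor 1/2 of the final bound arises. Obstacle: w'
    vanishes at pi/(2m), where w^-1 is not differentiable. Stopping at s0 keeps w' positive at all
    values of v, so one maximum principle works on the whole of M. As w is odd, only |v| is
    normalized, whatever the ratio of max v to min v. Strictness: the quotient of |grad v|^2 by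
    w'(w^-1(v))^2 is maximized. A maximum c > 1 leaves a positive surplus proportional to c - 1,
    which contradicts the maximum principle. *)

Section Lines.
Context {R : realType} {V : normedModType R}.
Implicit Types (f : V -> R) (y v : V) (t s : R).

(** The two difference quotients are equal as functions, so directional derivatives and derivatives
    along a line are exchanged by rewriting, with no limit argument. *)
Lemma line_quotient f y v t :
  (fun h : R => h^-1 *: (((fun s => f (y + s *: v)) \o shift t) (h *: 1)
                 - f (y + t *: v)))
  = (fun h : R => h^-1 *: ((f \o shift (y + t *: v)) (h *: v)
                 - f (y + t *: v))).
Proof.
apply/funext => h /=; congr (_ *: (f _ - _)).
by rewrite [h%:A]mulr1 scalerDl addrCA.
Qed.

Lemma derivable_line f y v t : derivable f (y + t *: v) v ->
  derivable (fun s => f (y + s *: v)) t 1.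
Proof. by rewrite /derivable line_quotient. Qed.

Lemma derive_line f y v t :
  'D_1 (fun s => f (y + s *: v)) t = 'D_v f (y + t *: v).
Proof. by rewrite /derive line_quotient. Qed.

Lemma is_derive_line f y v t : derivable f (y + t *: v) v ->
  is_derive t 1 (fun s => f (y + s *: v)) ('D_v f (y + t *: v)).
Proof.
by move=> df; apply: DeriveDef; [exact: derivable_line|exact: derive_line].
Qed.

Lemma is_derive_of_line f x v d :
  is_derive (0 : R) (1 : R) (fun s => f (x + s *: v)) d -> is_derive x v f d.
Proof.
move=> [d1 d2]; apply: DeriveDef.
  by move: d1; rewrite /derivable line_quotient scale0r addr0.
by rewrite -d2 derive_line scale0r addr0.
Qed.

(** In the applications [t] is a coordinate of an arbitrary displacement and may have either sign,
    hence the symmetric range of [s]. *)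
Lemma MVT_line f y v t :
  (forall s, `|s| <= `|t| -> derivable f (y + s *: v) v) ->
  exists2 s, `|s| <= `|t| & f (y + t *: v) - f y = t * 'D_v f (y + s *: v).
Proof.
move=> df; have f0 : f y = f (y + 0 *: v) by rewrite scale0r addr0.
have der s : `|s| <= `|t| ->
    is_derive s 1 (fun s => f (y + s *: v)) ('D_v f (y + s *: v)).
  by move=> st; apply: is_derive_line; exact: df.
have cont a b : (forall x, x \in `[a, b] -> `|x| <= `|t|) ->
    {within `[a, b], continuous (fun s => f (y + s *: v))}.
  move=> abt; apply: derivable_within_continuous => x xab.
  by have [] := der x (abt _ xab).
have [t0|t0|->] := ltgtP t 0.
- have tE : `|t| = - t by rewrite ltr0_norm.
  have ab x : x \in `[t, 0] -> `|x| <= `|t|.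
    by rewrite in_itv /= tE => /andP[tx x0]; rewrite ler0_norm ?lerN2.
  have [c ct] := MVT t0 (fun x xt => der x (ab x (subset_itv_oo_cc xt)))
    (cont _ _ ab).
  rewrite -f0 => cE; exists c; first exact/ab/subset_itv_oo_cc.
  by apply: oppr_inj; rewrite opprB cE; ring.
- have tE : `|t| = t by rewrite gtr0_norm.
  have ab x : x \in `[0, t] -> `|x| <= `|t|.
    by rewrite in_itv /= tE => /andP[x0 xt]; rewrite ger0_norm.
  have [c ct] := MVT t0 (fun x xt => der x (ab x (subset_itv_oo_cc xt)))
    (cont _ _ ab).
  rewrite -f0 => cE; exists c; first exact/ab/subset_itv_oo_cc.
  by rewrite cE; ring.
- by exists 0; rewrite // scale0r addr0 subrr mul0r.
Qed.

End Lines.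

(** * Continuous partial derivatives imply differentiability *)

Section Differentiability.
Context {R : realType} {n : nat}.
Local Notation V := 'rV[R]_n.
Implicit Types (f g : V -> R) (x y h : V) (U : set V).

Lemma differentiable_intro (W W' : normedModType R) (f : W -> W')
    (df : {linear W -> W'}) (x : W) :
  continuous df -> f \o shift x = cst (f x) + df +o_ 0 id ->
  differentiable f x.
Proof.
move=> dfc dxf; have dE := diff_unique dfc dxf.
by apply/diff_locallyP; rewrite dE.
Qed.

(** Corners of the staircase from 0 to [h] along the coordinate axes. Consecutive corners differ in
    one coordinate, so that only partial derivatives enter. *)
Definition row_prefix (k : nat) h : V :=
  \row_j (if (j < k)%N then h 0 j else 0).

Lemma row_prefix0 h : row_prefix 0 h = 0.
Proof. by apply/rowP => j; rewrite !mxE. Qed.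

Lemma row_prefixn h : row_prefix n h = h.
Proof. by apply/rowP => j; rewrite !mxE ltn_ord. Qed.

Lemma row_prefixS (i : 'I_n) h :
  row_prefix i.+1 h = row_prefix i h + h 0 i *: 'e_i.
Proof.
apply/rowP => j; rewrite !mxE eqxx /= ltnS leq_eqVlt.
have [->|ji] := eqVneq j i; first by rewrite ltnn eqxx mulr1 add0r.
by rewrite (negbTE (ji : nat_of_ord j != nat_of_ord i)) mulr0 addr0.
Qed.

Lemma rV_norm_le (h : V) (e : R) : 0 <= e ->
  (forall j, `|h 0 j| <= e) -> `|h| <= e.
Proof.
move=> e0 he; rewrite /Num.Def.normr/= mx_normrE.
by apply: bigmax_le => // -[i j] _; rewrite ord1.
Qed.

Lemma coord_norm_le (h : V) (j : 'I_n) : `|h 0 j| <= `|h|.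
Proof.
rewrite [leRHS]/Num.Def.normr/= mx_normrE.
exact: (le_bigmax _ (fun i => `|h i.1 i.2|) (0, j)).
Qed.

Lemma row_prefix_line_norm (i : 'I_n) h (s : R) : `|s| <= `|h 0 i| ->
  `|row_prefix i h + s *: 'e_i| <= `|h|.
Proof.
move=> sh; apply: rV_norm_le => // j; rewrite !mxE eqxx /=.
have [->|ji] := eqVneq j i.
  by rewrite ltnn add0r mulr1 (le_trans sh) ?coord_norm_le.
by rewrite mulr0 addr0; case: ifP => _; rewrite ?normr0 ?coord_norm_le.
Qed.

Lemma increment_telescope f x h :
  f (x + h) - f x =
  \sum_(i < n) (f (x + row_prefix i.+1 h) - f (x + row_prefix i h)).
Proof.
rewrite -(big_mkord xpredT
  (fun i => f (x + row_prefix i.+1 h) - f (x + row_prefix i h))).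
by rewrite telescope_sumr // row_prefixn row_prefix0 addr0.
Qed.

Definition gradient f x : V := \row_i partial i f x.

Lemma C1_increment f U x (e : R) : open U -> U x -> 0 < e ->
  (forall i y, U y -> derivable f y 'e_i) ->
  (forall i, {for x, continuous (partial i f)}) ->
  \forall h \near (0 : V),
   `|f (x + h) - f x - \sum_i h 0 i * partial i f x| <= e * `|h|.
Proof.
move=> oU Ux e0 df cf.
(* The error [e] is shared among the [n] steps of the staircase; [n.+1] keeps the divisor nonzero in
   dimension 0. *)
pose e' := e / n.+1%:R; have e'0 : 0 < e' by rewrite divr_gt0.
have : \forall y \near x, U y /\ forall i, `|partial i f y - partial i f x| < e'.
  near=> y; split; first by near: y; exact: open_nbhs_nbhs.
  move=> i; move: i; near: y; apply: filter_forall => i.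
  by have /cvgrPdistC_lt/(_ _ e'0) := cf i.
move=> /nbhs_ballP[r /= r0 rP].
apply/nbhs_ballP; exists r => //= h.
rewrite -ball_normE /= sub0r normrN => hr.
have rP' k : `|k| <= `|h| -> ball x r (x + k).
  by move=> kh; rewrite -ball_normE /= opprD addNKr normrN (le_lt_trans kh).
rewrite increment_telescope -sumrB.
apply: (le_trans (ler_norm_sum _ _ _)).
apply: (@le_trans _ _ (\sum_(i < n) e' * `|h|)); last first.
  rewrite sumr_const card_ord -mulrnAl ler_wpM2r //.
  rewrite /e' -mulr_natr -mulrA ler_piMr ?(ltW e0) //.
  by rewrite mulrC ler_pdivrMr // mul1r ler_nat.
apply: ler_sum => i _; rewrite row_prefixS addrA.
have [s sh|s sh ->] := @MVT_line _ _ f (x + row_prefix i h) 'e_i (h 0 i).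
  by apply: df; rewrite -addrA; apply: (rP _ (rP' _ _)).1;
    exact: row_prefix_line_norm.
rewrite -mulrBr normrM mulrC ler_pM // ?coord_norm_le //.
rewrite -addrA; apply/ltW/(rP _ (rP' _ _)).2; exact: row_prefix_line_norm.
Unshelve. all: by end_near. Qed.

Definition dot_row x h : R := \sum_i h 0 i * x 0 i.

Lemma dot_row_linear x : linear (dot_row x).
Proof.
move=> a h k; rewrite /dot_row scaler_sumr -big_split; apply: eq_bigr => i _ /=.
by rewrite !mxE mulrDl -mulrA.
Qed.

HB.instance Definition _ (x : V) :=
  GRing.isLinear.Build R V R _ (dot_row x) (dot_row_linear x).

(** [T] is arbitrary because the lemma also serves on [[0, 1]] with its subspace topology. *)
Lemma continuous_rsum (T : topologicalType) (I : Type) (r : seq I)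
    (F : I -> T -> R) (z : T) :
  (forall i, {for z, continuous (F i)}) ->
  {for z, continuous (fun t => \sum_(i <- r) F i t)}.
Proof.
move=> cF; by apply: cvg_big => [|i _]; [exact: add_continuous|exact: cF].
Qed.

Lemma C1_differentiable f U x : open U -> U x ->
  (forall i y, U y -> derivable f y 'e_i) ->
  (forall i, {for x, continuous (partial i f)}) ->
  differentiable f x.
Proof.
move=> oU Ux df cf.
apply: (@differentiable_intro _ _ _
    (dot_row (gradient f x) : {linear V -> R})).
  move=> h /=; apply: continuous_rsum => i.
  by apply: continuousM; [exact: coord_continuous|exact: cst_continuous].
apply/eqaddoP => e e0; near=> h; rewrite /= !fctE /= /dot_row.
under eq_bigr do rewrite mxE.
by rewrite opprD addrA [h + x]addrC; near: h;
  exact: C1_increment oU Ux e0 df cf.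
Unshelve. all: by end_near. Qed.

Lemma derive_gradient f x h : differentiable f x ->
  'D_h f x = \sum_i h 0 i * partial i f x.
Proof.
move=> df; rewrite deriveE // {1}[h]row_sum_delta linear_sum.
by apply: eq_bigr => i _; rewrite linearZ /= /partial deriveE.
Qed.

Lemma is_derive_curve f (gamma : R -> V) t :
  differentiable f (gamma t) -> derivable gamma t 1 ->
  is_derive t 1 (f \o gamma)
    (\sum_i (derive1 gamma t) 0 i * partial i f (gamma t)).
Proof.
move=> df /derivable1_diffP dg.
have dfg : differentiable (f \o gamma) t by exact: differentiable_comp.
apply: DeriveDef; first exact/derivable1_diffP.
rewrite -derive_gradient // (deriveE _ df) (deriveE _ dfg) (derive1E' dg).
by rewrite (diff_comp dg df).
Qed.

End Differentiability.

(** * The classes C^k and the symmetry of second derivatives *)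

Section PartialRules.
Context {R : realType} {n : nat}.
Local Notation V := 'rV[R]_n.
Implicit Types (f g : V -> R) (x y h v : V) (U : set V) (i j : 'I_n) (k : nat).

Lemma partial_congr U f g i x : open U -> U x ->
  (forall y, U y -> f y = g y) -> partial i f x = partial i g x.
Proof.
move=> oU Ux fg; apply: near_eq_derive.
by near=> y; apply: fg; near: y; exact: open_nbhs_nbhs.
Unshelve. all: by end_near. Qed.

Lemma derivable_congr U f g v x : open U -> U x ->
  (forall y, U y -> f y = g y) -> derivable f x v -> derivable g x v.
Proof.
move=> oU Ux fg; apply: near_eq_derivable.
by near=> y; apply: fg; near: y; exact: open_nbhs_nbhs.
Unshelve. all: by end_near. Qed.

Lemma continuous_congr U f g x : open U -> U x ->
  (forall y, U y -> f y = g y) -> {for x, continuous f} ->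
  {for x, continuous g}.
Proof.
move=> oU Ux fg cf; rewrite /prop_for /continuous_at -(fg x Ux).
apply: cvg_trans cf.
apply: (@near_eq_cvg _ _ (nbhs x) _ f g).
by near=> y; apply: fg; near: y; exact: open_nbhs_nbhs.
Unshelve. all: by end_near. Qed.

Lemma Ck_on_continuous k U f x : Ck_on k U f -> U x -> {for x, continuous f}.
Proof. by case: k => [|k] [cf _]; exact: cf. Qed.

Lemma Ck_onW k U f : Ck_on k.+1 U f -> Ck_on k U f.
Proof.
elim: k f => [|k IH] f; first by case.
by move=> [cf df]; split => // i; have [? ?] := df i; split => //; exact: IH.
Qed.

Lemma Ck_on_congr k U f g : open U -> (forall y, U y -> f y = g y) ->
  Ck_on k U f -> Ck_on k U g.
Proof.
move=> oU; elim: k f g => [|k IH] f g fg [cf df]; split => //.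
- by move=> x Ux; exact: continuous_congr fg (cf x Ux).
- by move=> x Ux; exact: continuous_congr fg (cf x Ux).
- move=> i; have [dfi ddf] := df i; split.
    by move=> x Ux; exact: derivable_congr fg (dfi x Ux).
  by apply: IH ddf => y Uy; exact: partial_congr fg.
Qed.

Lemma Ck_on_cst k U (c : R) : Ck_on k U (fun=> c).
Proof.
elim: k c => [|k IH] c; split => //; try by move=> x _; exact: cst_continuous.
move=> i; split; first by move=> x _; exact: derivable_cst.
rewrite (_ : partial i _ = fun=> 0); first exact: IH.
by apply/funext => x; exact: derive_cst.
Qed.

Lemma Ck_onD k U f g : open U -> Ck_on k U f -> Ck_on k U g ->
  Ck_on k U (fun x => f x + g x).
Proof.
move=> oU; elim: k f g => [|k IH] f g [cf df] [cg dg]; split => //.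
- by move=> x Ux; apply: continuousD; [exact: cf|exact: cg].
- by move=> x Ux; apply: continuousD; [exact: cf|exact: cg].
- move=> i; have [dfi ddf] := df i; have [dgi ddg] := dg i; split.
    by move=> x Ux; apply: derivableD; [exact: dfi|exact: dgi].
  apply: Ck_on_congr (IH _ _ ddf ddg) => // y Uy; apply/esym.
  by apply: deriveD; [exact: dfi|exact: dgi].
Qed.

Lemma partialM f g i x : derivable f x 'e_i -> derivable g x 'e_i ->
  partial i (fun y => f y * g y) x = partial i f x * g x + f x * partial i g x.
Proof.
by move=> df dg; rewrite /partial [LHS](deriveM df dg) addrC [X in X + _]mulrC.
Qed.

Lemma Ck_onM k U f g : open U -> Ck_on k U f -> Ck_on k U g ->
  Ck_on k U (fun x => f x * g x).
Proof.
move=> oU; elim: k f g => [|k IH] f g; move=> Cf Cg;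
  have [cf df] := Cf; have [cg dg] := Cg; split => //.
- by move=> x Ux; apply: continuousM; [exact: cf|exact: cg].
- by move=> x Ux; apply: continuousM; [exact: cf|exact: cg].
- move=> i; have [dfi ddf] := df i; have [dgi ddg] := dg i; split.
    by move=> x Ux; apply: derivableM; [exact: dfi|exact: dgi].
  have := Ck_onD oU (IH _ _ ddf (Ck_onW Cg)) (IH _ _ (Ck_onW Cf) ddg).
  apply: Ck_on_congr => // y Uy; apply/esym.
  by apply: partialM; [exact: dfi|exact: dgi].
Qed.

(** Restriction to the line through [x] reduces this to the one-variable chain rule, so [f] only has
    to be derivable in the direction [v]. *)
Lemma derive_scalar_comp (phi : R -> R) f (d : R) v x :
  is_derive (f x) 1 phi d -> derivable f x v ->
  is_derive x v (fun y => phi (f y)) (d * 'D_v f x).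
Proof.
move=> dphi df; pose l (s : R) := f (x + s *: v).
have l0 : l 0 = f x by rewrite /l scale0r addr0.
have dl : is_derive (0 : R) (1 : R) l ('D_v f x).
  by have := @is_derive_line _ _ f x v 0; rewrite scale0r addr0; apply.
have dpl : is_derive (0 : R) (1 : R) (phi \o l) (d * 'D_v f x).
  by apply: is_derive1_comp; rewrite l0.
exact: is_derive_of_line dpl.
Qed.

(** The input is the regularity of [dphi] composed with [f], so that regularity is gained one
    derivative at a time, both for inverses and for functions known only on a set [J] of values. *)
Lemma Ck_on_comp k U (J : set R) (phi dphi : R -> R) f : open U ->
  (forall x, U x -> J (f x)) ->
  (forall u, J u -> is_derive u 1 phi (dphi u)) ->
  Ck_on k.+1 U f -> Ck_on k U (fun x => dphi (f x)) ->
  Ck_on k.+1 U (fun x => phi (f x)).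
Proof.
move=> oU fJ dP Cf Cp; have [cf df] := Cf.
have cphi x : U x -> {for x, continuous (fun x => phi (f x))}.
  move=> Ux; apply: (@continuous_comp _ _ _ f phi); first exact: cf.
  apply/differentiable_continuous/derivable1_diffP.
  by have [] := dP _ (fJ _ Ux).
split => // i; have [dfi ddf] := df i.
have der x : U x ->
    is_derive x 'e_i (fun y => phi (f y)) (dphi (f x) * 'D_('e_i) f x).
  move=> Ux; apply: derive_scalar_comp; last exact: dfi.
  exact: dP (fJ _ Ux).
split; first by move=> x Ux; case: (der x Ux).
apply: Ck_on_congr (Ck_onM oU Cp ddf) => // y Uy.
by case: (der y Uy) => _; rewrite /partial => ->.
Qed.

Lemma Ck_onV k U f : open U -> (forall x, U x -> f x != 0) ->
  Ck_on k U f -> Ck_on k U (fun x => (f x)^-1).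
Proof.
move=> oU f0; elim: k => [|k IH] Cf.
  by split => // x Ux; apply: (continuousV (f0 x Ux));
    exact: (Ck_on_continuous Cf).
have Ci := IH (Ck_onW Cf).
(* The derivative is written as a polynomial in [u^-1], whose regularity is then given by the
   induction hypothesis. *)
apply: (@Ck_on_comp _ _ [set u | u != 0] (fun u => u^-1)
    (fun u => - 1 * (u^-1 * u^-1))) => //.
  move=> u /= u0; have := @is_deriveV R id u 1 1 u0 (is_derive_id u 1).
  by rewrite [X in is_derive _ _ _ X]mulr1 expr2 invfM mulN1r.
apply: Ck_onM => //; first exact: Ck_on_cst.
exact: Ck_onM.
Qed.

Lemma smooth_onD U f g : open U -> smooth_on U f -> smooth_on U g ->
  smooth_on U (fun x => f x + g x).
Proof. by move=> oU sf sg k; apply: Ck_onD. Qed.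

Lemma smooth_onM U f g : open U -> smooth_on U f -> smooth_on U g ->
  smooth_on U (fun x => f x * g x).
Proof. by move=> oU sf sg k; apply: Ck_onM. Qed.

Lemma smooth_on_cst U c : smooth_on U (fun=> c : R).
Proof. by move=> k; exact: Ck_on_cst. Qed.

Lemma smooth_onN U f : open U -> smooth_on U f -> smooth_on U (fun x => - f x).
Proof.
move=> oU sf; under [X in smooth_on _ X]funext do rewrite -mulN1r.
by apply: smooth_onM => //; exact: smooth_on_cst.
Qed.

Lemma smooth_onB U f g : open U -> smooth_on U f -> smooth_on U g ->
  smooth_on U (fun x => f x - g x).
Proof. by move=> oU sf sg; apply: smooth_onD => //; exact: smooth_onN. Qed.

Lemma smooth_onV U f : open U -> (forall x, U x -> f x != 0) ->
  smooth_on U f -> smooth_on U (fun x => (f x)^-1).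
Proof. by move=> oU f0 sf k; apply: Ck_onV. Qed.

Lemma smooth_on_congr U f g : open U -> (forall y, U y -> f y = g y) ->
  smooth_on U f -> smooth_on U g.
Proof. by move=> oU fg sf k; exact: Ck_on_congr fg (sf k). Qed.

Lemma smooth_on_sum U (I : Type) (r : seq I) (P : pred I) (F : I -> V -> R) :
  open U -> (forall t, smooth_on U (F t)) ->
  smooth_on U (fun x => \sum_(t <- r | P t) F t x).
Proof.
move=> oU sF; elim: r => [|t r IH].
  under [X in smooth_on _ X]funext do rewrite big_nil.
  exact: smooth_on_cst.
under [X in smooth_on _ X]funext do rewrite big_cons.
by case: (P t) => //; exact: smooth_onD.
Qed.

Lemma smooth_on_prod U (I : Type) (r : seq I) (P : pred I) (F : I -> V -> R) :
  open U -> (forall t, smooth_on U (F t)) ->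
  smooth_on U (fun x => \prod_(t <- r | P t) F t x).
Proof.
move=> oU sF; elim: r => [|t r IH].
  under [X in smooth_on _ X]funext do rewrite big_nil.
  exact: smooth_on_cst.
under [X in smooth_on _ X]funext do rewrite big_cons.
by case: (P t) => //; exact: smooth_onM.
Qed.

Lemma smooth_on_partial U f i : smooth_on U f -> smooth_on U (partial i f).
Proof. by move=> sf k; have [_ /(_ i)[]] := sf k.+1. Qed.

Lemma smooth_on_derivable U f i x : smooth_on U f -> U x -> derivable f x 'e_i.
Proof. by move=> sf Ux; have [_ /(_ i)[+ _]] := sf 1%N; apply. Qed.

Lemma Ck_on_differentiable k U f x : open U -> Ck_on k.+1 U f -> U x ->
  differentiable f x.
Proof.
move=> oU [_ df] Ux; apply: (C1_differentiable oU Ux).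
  by move=> i y Uy; exact: (df i).1.
by move=> i; exact: (Ck_on_continuous (df i).2).
Qed.

Lemma shift_quotient f x c v :
  (fun h : R => h^-1 *: (((fun y => f (y + c)) \o shift x) (h *: v) - f (x + c)))
  = (fun h : R => h^-1 *: ((f \o shift (x + c)) (h *: v) - f (x + c))).
Proof. by apply/funext => h /=; rewrite addrA. Qed.

Lemma derivable_shift f x c v : derivable f (x + c) v ->
  derivable (fun y => f (y + c)) x v.
Proof. by rewrite /derivable shift_quotient. Qed.

Lemma derive_shift_arg f x c v :
  'D_v (fun y => f (y + c)) x = 'D_v f (x + c).
Proof. by rewrite /derive shift_quotient. Qed.

Definition second_difference f x i j (s : R) :=
  f (x + s *: 'e_i + s *: 'e_j) - f (x + s *: 'e_i) - f (x + s *: 'e_j) + f x.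

Lemma norm_delta_le i (s : R) : `|s *: ('e_i : V)| <= `|s|.
Proof.
apply: rV_norm_le => // j; rewrite !mxE eqxx /=.
by case: eqP => _; rewrite ?mulr1 ?mulr0 ?normr0.
Qed.

(** Two mean value theorems: along ['e_i] for the increment of [f] in the direction ['e_j], then
    along ['e_j] for the partial derivative so obtained. *)
Lemma second_differenceE f x i j (r s : R) :
  (forall y, `|y - x| < r -> derivable f y 'e_i) ->
  (forall y, `|y - x| < r -> derivable (partial i f) y 'e_j) ->
  `|s| + `|s| < r ->
  exists2 y, `|y - x| < r &
    second_difference f x i j s = s ^+ 2 * partial j (partial i f) y.
Proof.
move=> df ddf sr.
have bnd (a b : R) : `|a| <= `|s| -> `|b| <= `|s| ->
    `|x + a *: 'e_i + b *: 'e_j - x| < r.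
  move=> a_s b_s; rewrite -(addrA x) addrAC subrr add0r.
  apply: le_lt_trans sr; rewrite (le_trans (ler_normD _ _)) //.
  by rewrite lerD // (le_trans (norm_delta_le _ _)).
have bnd0 (a : R) : `|a| <= `|s| -> `|x + a *: 'e_i - x| < r.
  by move=> a_s; have := bnd a 0 a_s; rewrite scale0r addr0 normr0; apply.
pose g y := f (y + s *: 'e_j) - f y.
have dg (a : R) : `|a| <= `|s| ->
    derivable (fun y => f (y + s *: 'e_j)) (x + a *: 'e_i) 'e_i.
  by move=> a_s; apply/derivable_shift/df/bnd.
have df' (a : R) : `|a| <= `|s| -> derivable f (x + a *: 'e_i) 'e_i.
  by move=> a_s; exact/df/bnd0.
have [a a_s|a a_s gE] := @MVT_line _ _ g x 'e_i s.
  by apply: derivableB; [exact: dg|exact: df'].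
have [b b_s|b b_s gE'] := @MVT_line _ _ (partial i f) (x + a *: 'e_i) 'e_j s.
  exact/ddf/bnd.
exists (x + a *: 'e_i + b *: 'e_j); first exact: bnd.
transitivity (g (x + s *: 'e_i) - g x).
  by rewrite /g /second_difference; ring.
rewrite gE (deriveB (dg a a_s) (df' a a_s)) derive_shift_arg.
by rewrite gE' expr2 -mulrA.
Qed.

Lemma second_difference_sym f x i j s :
  second_difference f x i j s = second_difference f x j i s.
Proof. by rewrite /second_difference (addrAC x); ring. Qed.

(** The second difference is symmetric in [i] and [j] and, divided by [s ^+ 2], it is as close as
    desired to either mixed derivative for small [s]. *)
Lemma partial_comm U f i j x : open U -> U x -> Ck_on 2 U f ->
  partial i (partial j f) x = partial j (partial i f) x.
Proof.
move=> oU Ux Cf; have [_ df] := Cf.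
have key p q (e : R) : 0 < e -> exists2 r : R, 0 < r &
   (forall s : R, `|s| + `|s| < r ->
      `|second_difference f x p q s - s ^+ 2 * partial q (partial p f) x|
      <= s ^+ 2 * e).
  move=> e0; have [dfp [cfp ddfp]] := df p.
  have : \forall y \near x, U y /\
      `|partial q (partial p f) y - partial q (partial p f) x| < e.
    apply: filterI; first exact: open_nbhs_nbhs.
    have := (ddfp q).2.1 x Ux.
    by move=> /cvgrPdistC_lt/(_ _ e0).
  move=> /nbhs_ballP[r0 /= r00 rP]; exists r0 => // s sr.
  have rP' y : `|y - x| < r0 -> ball x r0 y by rewrite -ball_normE /= distrC.
  have [y yr|y yr|y yr ->] := @second_differenceE f x p q r0 s _ _ sr.
  - by have [/dfp] := rP _ (rP' _ yr).
  - by have [Uy _] := rP _ (rP' _ yr); exact: (ddfp q).1.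
  - rewrite -mulrBr normrM ger0_norm ?sqr_ge0 // ler_wpM2l ?sqr_ge0 //.
    by apply/ltW; have [] := rP _ (rP' _ yr).
apply/eqP; rewrite -subr_eq0 -normr_eq0; apply/eqP/le_anti.
rewrite normr_ge0 andbT; apply/ler_addgt0Pr => e e0; rewrite add0r.
have e20 : 0 < e / 2 by rewrite divr_gt0.
have [r r0 r1] := key i j _ e20; have [r' r'0 r2] := key j i _ e20.
have [s s0 ss] : exists2 s : R, 0 < s & `|s| + `|s| < Num.min r r'.
  have : 0 < Num.min r r' by rewrite lt_min r0.
  move: (Num.min r r') => m m0; exists (m / 4); first by rewrite divr_gt0.
  by rewrite gtr0_norm ?divr_gt0 //; lra.
move: ss; rewrite lt_min => /andP[sr sr'].
have := lerD (r1 s sr) (r2 s sr'); rewrite second_difference_sym.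
set A := partial i _ x; set B := partial j _ x; set D := second_difference _ _ _ _ _.
move=> le1; have s20 : 0 < s ^+ 2 by rewrite exprn_gt0.
rewrite -(ler_pM2l s20) -[X in X * _ <= _]gtr0_norm // -normrM.
rewrite (_ : s ^+ 2 * (A - B) = (D - s ^+ 2 * B) - (D - s ^+ 2 * A)); last by ring.
by rewrite (le_trans (ler_normB _ _)) // (le_trans le1) // -mulrDr -splitr.
Qed.

End PartialRules.

(** * Linear algebra *)

Section QuadraticForms.
Context {R : realType}.

Definition posdef n (A : 'M[R]_n) :=
  forall X : 'rV[R]_n, X != 0 -> 0 < quad A X.

Lemma posdef_unitmx n (A : 'M[R]_n) : posdef A -> A \in unitmx.
Proof.
move=> pA; rewrite -row_free_unit -kermx_eq0.
apply/negPn/negP => /rowV0Pn[X /sub_kermxP XA X0].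
by have := pA _ X0; rewrite /quad XA mul0mx mxE ltxx.
Qed.

Lemma quadD n (A B : 'M[R]_n) X : quad (A + B) X = quad A X + quad B X.
Proof. by rewrite /quad mulmxDr mulmxDl mxE. Qed.

Lemma quadZ n (a : R) (A : 'M[R]_n) X : quad (a *: A) X = a * quad A X.
Proof. by rewrite /quad -scalemxAr -scalemxAl mxE. Qed.

Lemma quadE n (A : 'M[R]_n) X :
  quad A X = \sum_i \sum_j X 0 i * A i j * X 0 j.
Proof.
rewrite /quad mxE exchange_big; apply: eq_bigr => j _ /=.
by rewrite mxE [X^T _ _]mxE big_distrl.
Qed.

Lemma quad_sqr n (r X : 'rV[R]_n) : quad (r^T *m r) X = (X *m r^T) 0 0 ^+ 2.
Proof.
rewrite /quad mulmxA -mulmxA mxE big_ord1 expr2; congr (_ * _).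
by rewrite -[r *m X^T]trmxK trmx_mul trmxK mxE.
Qed.

(* Completing the square in the first variable, by induction on [n]. *)
Lemma posdef_gram n (A : 'M[R]_n) : A^T = A -> posdef A ->
  exists m, exists P : 'M[R]_(m, n), A = P^T *m P.
Proof.
elim: n A => [|n IH] A sA pA.
  by exists 0%N, 0; apply/matrixP => -[].
pose B : 'M[R]_(1 + n) := A.
pose r : 'rV[R]_(1 + n) := row 0 B; pose a := B 0 0.
have sB i j : B i j = B j i by have /matrixP/(_ j i) := sA; rewrite mxE.
have a0 : 0 < a.
  have e0 : (delta_mx 0 0 : 'rV[R]_(1 + n)) != 0.
    by apply/eqP => /matrixP/(_ 0 0)/eqP; rewrite !mxE !eqxx oner_eq0.
  by have := pA _ e0; rewrite /quad -rowE trmx_delta -colE !mxE.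
pose C := B - a^-1 *: (r^T *m r).
have CE i j : C i j = B i j - a^-1 * (B 0 i * B 0 j).
  by rewrite !mxE big_ord1 !mxE.
have C0 j : C 0 j = 0.
  by rewrite CE mulKf ?gt_eqF // subrr.
have C0' i : C i 0 = 0.
  by rewrite CE sB [B 0 i * _]mulrC mulKf ?gt_eqF // subrr.
pose S : 'M[R]_n := drsubmx C.
have BE : B = a^-1 *: (r^T *m r) + C by rewrite addrC subrK.
have qC (X : 'rV[R]_(1 + n)) : quad C X = quad S (rsubmx X).
  rewrite !quadE big_ord_recl big1 ?add0r; last first.
    by move=> j _; rewrite C0 mulr0 mul0r.
  apply: eq_bigr => i _; rewrite big_ord_recl C0' mulr0 mul0r add0r.
  apply: eq_bigr => j _; rewrite !mxE !rshift1; congr (_ * _ * _).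
have SE' i j : S i j = C (rshift 1 i) (rshift 1 j).
  by rewrite [LHS]mxE [LHS]mxE.
have sS : S^T = S.
  apply/matrixP => i j; rewrite mxE !SE' !CE sB; congr (_ - _ * _).
  exact: mulrC.
have pS : posdef S.
  move=> Y Y0.
  (* The first coordinate makes [X] orthogonal to [r]: the square vanishes at [X], and positivity of
     [A] at [X] becomes positivity of [S] at [Y]. *)
  pose X : 'rV[R]_(1 + n) := row_mx (- a^-1 *: (Y *m (rsubmx r)^T)) Y.
  have X0 : X != 0 by rewrite row_mx_eq0 negb_and Y0 orbT.
  have := pA X X0; rewrite -/B BE quadD quadZ quad_sqr qC row_mxKr.
  suff -> : X *m r^T = 0 by rewrite mxE expr2 mul0r mulr0 add0r.
  rewrite -{1}[r]hsubmxK tr_row_mx mul_row_col.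
  have -> : (lsubmx r)^T = a%:M.
    by apply/matrixP => i j; rewrite !ord1 !mxE lshift0 eqxx mulr1n.
  rewrite -scalemxAl mul_mx_scalar scalerA mulNr mulVf ?gt_eqF //.
  by rewrite scaleN1r addNr.
have [m [P SE]] := IH S sS pS.
pose P1 : 'M[R]_(m, 1 + n) := row_mx 0 P.
have CP : C = P1^T *m P1.
  rewrite /P1 tr_row_mx trmx0 mul_col_row !mul0mx mulmx0 -SE -[C]submxK.
  by congr block_mx; apply/matrixP => i j;
    rewrite ?ord1 mxE mxE ?lshift0 ?C0 ?C0' ?mxE.
exists (1 + m)%N, (col_mx ((Num.sqrt a)^-1 *: r) P1).
rewrite -/B BE tr_col_mx mul_row_col CP; congr (_ + _).
rewrite [(_ *: r)^T]linearZ /= -scalemxAl -scalemxAr scalerA -invfM -expr2.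
by rewrite sqr_sqrtr // ltW.
Qed.

Lemma trace_quad m n (P : 'M[R]_(m, n)) (B : 'M[R]_n) :
  \tr (P^T *m P *m B) = \sum_a quad B (row a P).
Proof.
rewrite -mulmxA mxtrace_mulC; apply: eq_bigr => a _.
rewrite /quad -row_mul mxE [RHS]mxE.
by apply: eq_bigr => j _; rewrite [row a (P *m B) _ _]mxE !mxE.
Qed.

(** A Gram factorization of [A] turns the trace into a sum of values of [quad B]. In the application
    [A] is the inverse metric and [B] the matrix of second derivatives at a maximum. *)
Lemma trace_nonpos n (A B : 'M[R]_n) : A^T = A -> posdef A ->
  (forall X, quad B X <= 0) -> \tr (A *m B) <= 0.
Proof.
move=> sA pA nB; have [m [P ->]] := posdef_gram sA pA.
by rewrite trace_quad sumr_le0.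
Qed.

(** For [A = P^T *m P] the trace is the squared Frobenius norm of the symmetric matrix
    [P *m B *m P^T]. With [A] the inverse metric, it is the squared norm of the tensor [B]. *)
Lemma trace_sqr_ge0 n (A B : 'M[R]_n) : A^T = A -> posdef A -> B^T = B ->
  0 <= \tr (A *m B *m A *m B).
Proof.
move=> sA pA sB; have [m [P ->]] := posdef_gram sA pA.
pose C := P *m B *m P^T.
have -> : \tr (P^T *m P *m B *m (P^T *m P) *m B) = \tr (C^T *m C).
  have -> : C^T = C by rewrite /C !trmx_mul trmxK sB mulmxA.
  by rewrite -!mulmxA mxtrace_mulC /C !mulmxA.
apply: sumr_ge0 => i _; rewrite mxE; apply: sumr_ge0 => j _.
by rewrite mxE -expr2 sqr_ge0.
Qed.

Lemma posdef_invmx n (A : 'M[R]_n) : A^T = A -> posdef A -> posdef (invmx A).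
Proof.
move=> sA pA X X0; have uA := posdef_unitmx pA.
have X1 : X *m invmx A != 0.
  apply/eqP => XA; case/eqP: X0.
  by rewrite -[X](mulmxKV uA) XA mul0mx.
have := pA _ X1; rewrite /quad trmx_mul trmx_inv sA.
by rewrite mulmxKV // mulmxA.
Qed.

Lemma posdef_quad_ge0 n (A : 'M[R]_n) X : posdef A -> 0 <= quad A X.
Proof.
move=> pA; have [->|X0] := eqVneq X 0; last exact/ltW/pA.
by rewrite /quad !mul0mx mxE.
Qed.

End QuadraticForms.

(** * First and second order conditions at a maximum *)

Section LocalMaximum.
Context {R : realType}.

Lemma local_max_deriv2 (phi psi : R -> R) (r c : R) : 0 < r ->
  (forall s : R, `|s| < r -> is_derive s (1 : R) phi (psi s)) ->
  (forall s : R, `|s| < r -> phi s <= phi 0) ->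
  is_derive (0 : R) (1 : R) psi c -> psi 0 = 0 /\ c <= 0.
Proof.
move=> r0 dphi mphi dpsi.
have itvE s : s \in `](- r), r[ -> `|s| < r by rewrite in_itv /= ltr_norml.
have psi0 : psi 0 = 0.
  have d0 : is_derive (0 : R) (1 : R) phi 0.
    apply: (@derive1_at_max _ phi (- r) r); first by rewrite ge0_cp // ltW.
    - by move=> s /itvE sr; case: (dphi s sr).
    - by rewrite in_itv /= oppr_lt0 r0.
    - by move=> s /itvE; exact: mphi.
  have d1 : is_derive (0 : R) (1 : R) phi (psi 0).
    by apply: dphi; rewrite normr0.
  by case: d1 => _ <-; case: d0.
split=> //; rewrite leNgt; apply/negP => c0.
(* Caratheodory's form: [psi s = s * g s] with [g] continuous at 0 and [g 0 = c]. If [c > 0], then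
   [psi] is positive just to the right of 0, where [phi] would increase. *)
have [g [gE gc g0]] := (is_derive1_caratheodory psi 0 c).1 dpsi.
have : \forall z \near (0 : R), 0 < g z.
  by apply: (cvgr_gt _ gc); rewrite g0.
move=> /nbhs_ballP[d /= d0 dP].
pose e := Num.min r d / 2.
have m0 : 0 < Num.min r d by rewrite lt_min r0.
have e0 : 0 < e by rewrite divr_gt0.
have em : e < Num.min r d by rewrite /e ltr_pdivrMr // ltr_pMr // ltr1n.
move: em; rewrite lt_min => /andP[er ed].
have nb x : x \in `[0, e] -> `|x| < r.
  by rewrite in_itv /= => /andP[x0 xe]; rewrite ger0_norm // (le_lt_trans xe).
have cont : {within `[0, e], continuous phi}.
  apply: derivable_within_continuous => x xe.
  by case: (dphi x (nb x xe)).
have [x xe] := MVT e0 (fun x xe => dphi x (nb x (subset_itv_oo_cc xe))) cont.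
move: (xe); rewrite in_itv /= => /andP[x0 xlt] E.
have : 0 < psi x.
  have := gE x; rewrite psi0 !subr0 => ->; rewrite mulr_gt0 //; apply: dP.
  by rewrite /= /ball /= sub0r normrN gtr0_norm // (lt_trans xlt).
move=> px; have : 0 < phi e - phi 0 by rewrite E mulr_gt0 // subr0.
by rewrite subr_gt0 ltNge mphi // gtr0_norm.
Qed.

Context {n : nat}.
Local Notation V := 'rV[R]_n.
Implicit Types (f : V -> R) (x X : V) (U : set V).

Definition hess_mx f x : 'M[R]_n := \matrix_(i, j) partial i (partial j f) x.

Lemma local_max_test U f x : open U -> U x -> Ck_on 2 U f ->
  (forall y, U y -> f y <= f x) ->
  (forall i, partial i f x = 0) /\ forall X, quad (hess_mx f x) X <= 0.
Proof.
move=> oU Ux Cf fx.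
have key X : \sum_i X 0 i * partial i f x = 0 /\ quad (hess_mx f x) X <= 0.
  have /nbhs_ballP[d /= d0 dP] : nbhs x U by exact: open_nbhs_nbhs.
  (* Adding 1 keeps the quotient meaningful for [X = 0]. *)
  pose r := d / (`|X| + 1); have X1 : 0 < `|X| + 1 by rewrite ltr_wpDl.
  have r0 : 0 < r by rewrite divr_gt0.
  have rU (s : R) : `|s| < r -> U (x + s *: X).
    move=> sr; apply: dP; rewrite -ball_normE /= opprD addNKr normrN normrZ.
    have [->|X0] := eqVneq X 0; first by rewrite normr0 mulr0.
    move: sr; rewrite /r ltr_pdivlMr //; apply: le_lt_trans.
    by rewrite ler_wpM2l // lerDl.
  pose psi s := \sum_i X 0 i * partial i f (x + s *: X).
  have dphi (s : R) : `|s| < r ->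
      is_derive s (1 : R) (fun s => f (x + s *: X)) (psi s).
    move=> sr; have dxs : differentiable f (x + s *: X).
      exact: Ck_on_differentiable oU Cf (rU s sr).
    rewrite /psi -derive_gradient //; apply: is_derive_line.
    exact: diff_derivable.
  have mphi (s : R) : `|s| < r -> f (x + s *: X) <= f (x + 0 *: X).
    by move=> sr; rewrite scale0r addr0; apply/fx/rU.
  have dpsi : is_derive (0 : R) (1 : R) psi (quad (hess_mx f x) X).
    rewrite /psi; have -> : quad (hess_mx f x) X =
        \sum_i X 0 i * \sum_j X 0 j * partial j (partial i f) x.
      rewrite quadE; apply: eq_bigr => i _; rewrite big_distrr /=.
      apply: eq_bigr => j _; rewrite mxE (partial_comm i j oU Ux Cf).
      by ring.
    rewrite -fct_sumE; apply: is_derive_sum => i.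
    have di : differentiable (partial i f) x.
      by have [_ /(_ i)[_ Ci]] := Cf; exact: (@Ck_on_differentiable _ _ 0 U).
    rewrite -derive_gradient //.
    apply: is_deriveZ; rewrite -[x in 'D_X _ x]addr0 -(scale0r X).
    by apply: is_derive_line; rewrite scale0r addr0; exact: diff_derivable.
  have [psi0 h] := local_max_deriv2 r0 dphi mphi dpsi; split=> //.
  by move: psi0; rewrite /psi scale0r addr0.
split; last by move=> X; have [] := key X.
move=> i; have [+ _] := key 'e_i; rewrite (bigD1 i) //= big1 ?addr0.
  by rewrite mxE !eqxx mul1r.
by move=> j ji; rewrite mxE eqxx (negbTE ji) mul0r.
Qed.

End LocalMaximum.

(** * Matrix-valued functions *)

Section MatrixCalculus.
Context {R : realType} {n : nat}.
Local Notation V := 'rV[R]_n.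
Context {U : set V} (oU : open U).
Implicit Types (x y : V) (i j : 'I_n).

Definition smooth_mx p q (A : V -> 'M[R]_(p, q)) :=
  forall a b, smooth_on U (fun x => A x a b).

Definition partial_mx i p q (A : V -> 'M[R]_(p, q)) x : 'M[R]_(p, q) :=
  \matrix_(a, b) partial i (fun y => A y a b) x.

Lemma partial_mx_entry i p q (A : V -> 'M[R]_(p, q)) x a b :
  partial_mx i A x a b = partial i (fun y => A y a b) x.
Proof. by rewrite mxE. Qed.

Lemma partial_mx_congr i p q (A B : V -> 'M[R]_(p, q)) x : U x ->
  (forall y, U y -> A y = B y) -> partial_mx i A x = partial_mx i B x.
Proof.
move=> Ux AB; apply/matrixP => a b; rewrite !mxE.
by apply: (partial_congr _ oU Ux) => y /AB ->.
Qed.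

Lemma smooth_mx_congr p q (A B : V -> 'M[R]_(p, q)) :
  (forall y, U y -> A y = B y) -> smooth_mx A -> smooth_mx B.
Proof.
by move=> AB sA a b; apply: (smooth_on_congr oU _ (sA a b)) => y /AB ->.
Qed.

Lemma smooth_partial_mx i p q (A : V -> 'M[R]_(p, q)) :
  smooth_mx A -> smooth_mx (partial_mx i A).
Proof.
move=> sA a b; under [X in smooth_on _ X]funext do rewrite mxE.
exact: smooth_on_partial.
Qed.

Lemma smooth_mxD p q (A B : V -> 'M[R]_(p, q)) :
  smooth_mx A -> smooth_mx B -> smooth_mx (fun x => A x + B x).
Proof.
move=> sA sB a b; under [X in smooth_on _ X]funext do rewrite mxE.
exact: smooth_onD.
Qed.

Lemma smooth_mxZ (c : R) p q (A : V -> 'M[R]_(p, q)) :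
  smooth_mx A -> smooth_mx (fun x => c *: A x).
Proof.
move=> sA a b; under [X in smooth_on _ X]funext do rewrite mxE.
by apply: smooth_onM => //; exact: smooth_on_cst.
Qed.

Lemma smooth_mxN p q (A : V -> 'M[R]_(p, q)) :
  smooth_mx A -> smooth_mx (fun x => - A x).
Proof.
move=> sA a b; under [X in smooth_on _ X]funext do rewrite mxE.
exact: smooth_onN.
Qed.

Lemma smooth_mxM p q r (A : V -> 'M[R]_(p, q)) (B : V -> 'M[R]_(q, r)) :
  smooth_mx A -> smooth_mx B -> smooth_mx (fun x => A x *m B x).
Proof.
move=> sA sB a b; under [X in smooth_on _ X]funext do rewrite mxE.
by apply: smooth_on_sum => // c; exact: smooth_onM.
Qed.

Lemma smooth_mx_tr p q (A : V -> 'M[R]_(p, q)) :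
  smooth_mx A -> smooth_mx (fun x => (A x)^T).
Proof.
move=> sA a b; under [X in smooth_on _ X]funext do rewrite mxE.
exact: sA.
Qed.

Lemma smooth_on_det p (A : V -> 'M[R]_p) : smooth_mx A ->
  smooth_on U (fun x => \det (A x)).
Proof.
move=> sA; apply: smooth_on_sum => // s; apply: smooth_onM => //.
  exact: smooth_on_cst.
by apply: smooth_on_prod => [|i]; [exact: oU|exact: sA].
Qed.

(** Cramer's rule: on [U] the inverse is the adjugate divided by the determinant, both polynomial in
    the entries. *)
Lemma smooth_invmx p (A : V -> 'M[R]_p) : smooth_mx A ->
  (forall x, U x -> A x \in unitmx) -> smooth_mx (fun x => invmx (A x)).
Proof.
move=> sA uA; have key : smooth_mx (fun x => (\det (A x))^-1 *: \adj (A x)).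
  move=> a b; under [X in smooth_on _ X]funext do rewrite !mxE.
  apply: smooth_onM => //.
    apply: smooth_onV => //; last exact: smooth_on_det.
    by move=> x /uA; rewrite unitmxE unitfE.
  apply: smooth_onM => //; first exact: smooth_on_cst.
  apply: smooth_on_det => c d.
  under [X in smooth_on _ X]funext do rewrite !mxE.
  exact: sA.
by apply: smooth_mx_congr key => y Uy; rewrite /invmx uA.
Qed.

Lemma partialD (f g : V -> R) i x : derivable f x 'e_i -> derivable g x 'e_i ->
  partial i (fun y => f y + g y) x = partial i f x + partial i g x.
Proof. exact: deriveD. Qed.

Lemma partial_sum m (F : 'I_m -> V -> R) i x :
  (forall t, derivable (F t) x 'e_i) ->
  partial i (fun y => \sum_t F t y) x = \sum_t partial i (F t) x.
Proof. by move=> dF; rewrite -fct_sumE; exact: derive_sum. Qed.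

Lemma partial_mxD i p q (A B : V -> 'M[R]_(p, q)) x : U x ->
  smooth_mx A -> smooth_mx B ->
  partial_mx i (fun y => A y + B y) x = partial_mx i A x + partial_mx i B x.
Proof.
move=> Ux sA sB; apply/matrixP => a b; rewrite !mxE.
under [X in partial i X]funext do rewrite mxE.
by apply: partialD; apply: smooth_on_derivable Ux.
Qed.

Lemma partial_mxZ i (c : R) p q (A : V -> 'M[R]_(p, q)) x : U x ->
  smooth_mx A -> partial_mx i (fun y => c *: A y) x = c *: partial_mx i A x.
Proof.
move=> Ux sA; apply/matrixP => a b; rewrite !mxE.
under [X in partial i X]funext do rewrite mxE.
by apply: deriveZ; apply: smooth_on_derivable Ux.
Qed.

Lemma partial_mxN i p q (A : V -> 'M[R]_(p, q)) x : U x ->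
  smooth_mx A -> partial_mx i (fun y => - A y) x = - partial_mx i A x.
Proof.
move=> Ux sA; apply/matrixP => a b; rewrite !mxE.
under [X in partial i X]funext do rewrite mxE.
by apply: deriveN; apply: smooth_on_derivable Ux.
Qed.

Lemma partial_mxM i p q r (A : V -> 'M[R]_(p, q)) (B : V -> 'M[R]_(q, r)) x :
  U x -> smooth_mx A -> smooth_mx B ->
  partial_mx i (fun y => A y *m B y) x =
  partial_mx i A x *m B x + A x *m partial_mx i B x.
Proof.
move=> Ux sA sB; apply/matrixP => a b; rewrite !mxE -big_split /=.
under [X in partial i X]funext do rewrite mxE.
rewrite partial_sum => [|c].
  apply: eq_bigr => c _; rewrite !mxE.
  by apply: partialM; apply: smooth_on_derivable Ux.
by apply: derivableM; apply: smooth_on_derivable Ux.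
Qed.

Lemma partial_mx_tr i p q (A : V -> 'M[R]_(p, q)) x :
  partial_mx i (fun y => (A y)^T) x = (partial_mx i A x)^T.
Proof.
apply/matrixP => a b; rewrite !mxE.
by under [X in partial i X]funext do rewrite mxE.
Qed.

Lemma partial_mx_cst i p q (A : 'M[R]_(p, q)) x :
  partial_mx i (fun=> A) x = 0.
Proof. by apply/matrixP => a b; rewrite !mxE; exact: derive_cst. Qed.

Lemma partial_mx_comm i j p q (A : V -> 'M[R]_(p, q)) x : U x ->
  smooth_mx A ->
  partial_mx i (partial_mx j A) x = partial_mx j (partial_mx i A) x.
Proof.
move=> Ux sA; apply/matrixP => a b.
rewrite [LHS]partial_mx_entry [RHS]partial_mx_entry.
have E k : (fun y => partial_mx k A y a b) = partial k (fun y => A y a b).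
  by apply/funext => y; exact: partial_mx_entry.
rewrite (E i) (E j).
exact: (partial_comm _ _ oU Ux (sA a b 2%N)).
Qed.

(** Obtained by differentiating the product [A *m invmx A], which is the identity matrix on [U]. *)
Lemma partial_invmx i p (A : V -> 'M[R]_p) x : U x -> smooth_mx A ->
  (forall x, U x -> A x \in unitmx) ->
  partial_mx i (fun y => invmx (A y)) x =
  - (invmx (A x) *m partial_mx i A x *m invmx (A x)).
Proof.
move=> Ux sA uA; have sI := smooth_invmx sA uA.
have : partial_mx i (fun y => A y *m invmx (A y)) x = 0.
  rewrite -[RHS](partial_mx_cst i 1%:M x).
  by apply: partial_mx_congr => // y Uy; rewrite mulmxV // uA.
rewrite partial_mxM // => /eqP; rewrite addrC addr_eq0 => /eqP E.
rewrite -[LHS](mulKmx (uA _ Ux)) E mulmxN; congr (- _).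
by rewrite mulmxA.
Qed.

End MatrixCalculus.

(** * The Bochner formula *)

(* Reduces an additive identity between matrix products to one between their
   entries, the products being opaque. *)
Ltac mx_additive :=
  repeat match goal with
  | |- context [@mulmx ?T ?m ?n ?p ?A ?B] => let P := fresh "P" in
      set P := (@mulmx T m n p A B); clearbody P
  end;
  let a := fresh "a" in let b := fresh "b" in
  apply/matrixP => a b; rewrite !mxE; ring.

Lemma trmxD (R : nzRingType) m n (A B : 'M[R]_(m, n)) :
  (A + B)^T = A^T + B^T.
Proof. exact: linearD. Qed.

Lemma trmxN (R : nzRingType) m n (A : 'M[R]_(m, n)) : (- A)^T = - A^T.
Proof. exact: linearN. Qed.

(** This and the next three identities isolate the algebra of the tensor calculus below. Here [A],
    [B] stand for the connection matrices of indices i, j, [P] for the i-th derivative of [B], [Q]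
    for the j-th derivative of [A], and [h] for the inverse metric. The right-hand side is, up to
    sign, the difference of the two mixed second derivatives of [h]. *)
Lemma curvature_skew_identity (R : comNzRingType) n (A B P Q h : 'M[R]_n) :
  (P - Q + (A *m B - B *m A)) *m h + h *m (P - Q + (A *m B - B *m A))^T
  = (P *m h - B *m (A *m h + h *m A^T)
      + (h *m P^T - (A *m h + h *m A^T) *m B^T))
   - (Q *m h - A *m (B *m h + h *m B^T)
      + (h *m Q^T - (B *m h + h *m B^T) *m A^T)).
Proof.
rewrite !(trmxD, trmxN) !trmx_mul.
rewrite !(mulmxDl, mulmxDr, mulmxBl, mulmxBr, mulNmx, mulmxN) !mulmxA.
by mx_additive.
Qed.

Lemma curvature_comm_identity (R : comNzRingType) n (A B P Q : 'M[R]_n)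
    (g r s D S : 'rV[R]_n) :
  D - (r + g *m A) *m B - g *m P - s *m A - S
  - (D - (s + g *m B) *m A - g *m Q - r *m B - S)
  = - (g *m (P - Q + (A *m B - B *m A))).
Proof.
rewrite !(mulmxDl, mulmxDr, mulmxBr, mulmxN) !mulmxA.
by mx_additive.
Qed.

Lemma trace_transport_identity (R : comNzRingType) n (A h H P : 'M[R]_n) :
  \tr (- (A *m h + h *m A^T) *m H + h *m P) =
  \tr (h *m (P - H *m A - A^T *m H)).
Proof.
have tA : \tr (A *m h *m H) = \tr (h *m H *m A).
  by rewrite -mulmxA mxtrace_mulC.
rewrite !(mulNmx, mulmxDl, mulmxDr, mulmxN, mulmxA, opprD) !mxtraceD.
rewrite ![\tr (- _)]raddfN /= tA.
set a := \tr _; set b := \tr _; set c := \tr _.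
by rewrite -/a -/b -/c; ring.
Qed.

Lemma row_hessian_identity (R : comNzRingType) n (A h H P : 'M[R]_n)
    (r X : 'rV[R]_n) :
  (r *m h - X *m A^T) *m H + X *m P - X *m H *m A =
  r *m h *m H + X *m (P - H *m A - A^T *m H).
Proof.
rewrite !(mulmxDl, mulmxDr, mulNmx, mulmxN) !mulmxA.
by mx_additive.
Qed.

Section Bochner.
Context {R : realType} {n : nat}.
Local Notation V := 'rV[R]_n.
Context {U : set V} (oU : open U) (G : V -> 'M[R]_n).
Hypothesis smoothG : @smooth_mx R n U n n G.
Hypothesis symG : forall x, U x -> (G x)^T = G x.
Hypothesis posG : forall x, U x -> posdef (G x).
Implicit Types (x y : V) (i j k : 'I_n).

Let smooth p q := @smooth_mx R n U p q.
Let unitG x : U x -> G x \in unitmx.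
Proof. by move=> /posG /posdef_unitmx. Qed.

Definition inv_metric x := invmx (G x).
Local Notation h := inv_metric.

Lemma smooth_inv_metric : smooth h.
Proof. exact: smooth_invmx. Qed.

Lemma sym_inv_metric x : U x -> (h x)^T = h x.
Proof. by move=> Ux; rewrite trmx_inv symG. Qed.

(** Twice the Christoffel symbols of the first kind, [l] being the index to be raised. *)
Definition metric_derivs i x : 'M[R]_n := \matrix_(l, j)
  (partial i (fun y => G y j l) x + partial j (fun y => G y i l) x
   - partial l (fun y => G y i j) x).

(** The connection form on the [i]-th coordinate field, as a matrix acting on columns. This encoding
    replaces index computations by matrix identities: a covector, kept as a row, is corrected by a
    product on the right, and a bilinear form by one product on each side. *)
Definition connection i x : 'M[R]_n := \matrix_(k, j) christoffel G k i j x.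
Local Notation Gam := connection.

Lemma connectionE i x : Gam i x = 2^-1 *: (h x *m metric_derivs i x).
Proof.
apply/matrixP => k j; rewrite !mxE; congr (_ * _).
by apply: eq_bigr => l _; rewrite !mxE.
Qed.

Lemma smooth_connection i : smooth (Gam i).
Proof.
have -> : Gam i = fun x => 2^-1 *: (h x *m metric_derivs i x).
  by apply/funext => x; exact: connectionE.
apply/smooth_mxZ/smooth_mxM => //; first exact: smooth_inv_metric.
move=> l j; under [X in smooth_on _ X]funext do rewrite mxE.
by apply: smooth_onB => //; [apply: smooth_onD => //|];
  apply: smooth_on_partial; exact: smoothG.
Qed.

Lemma partial_metric_sym i j k x : U x ->
  partial i (fun y => G y j k) x = partial i (fun y => G y k j) x.
Proof.
move=> Ux; apply: (partial_congr _ oU Ux) => y Uy.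
by rewrite -[in LHS](symG Uy) mxE.
Qed.

Lemma connection_sym i j k x : U x -> Gam i x k j = Gam j x k i.
Proof.
move=> Ux; rewrite !mxE; congr (_ * _); apply: eq_bigr => l _; congr (_ * _).
by rewrite (partial_metric_sym l i j Ux) [X in X - _]addrC.
Qed.

(** Compatibility of the connection with the metric: symmetrizing the symbols of the first kind in
    [l] and [j] cancels two of the three derivatives. *)
Lemma partial_metric i x : U x ->
  partial_mx i G x = G x *m Gam i x + (Gam i x)^T *m G x.
Proof.
move=> Ux; have GG : G x *m Gam i x = 2^-1 *: metric_derivs i x.
  by rewrite connectionE -scalemxAr mulmxA mulmxV ?unitG // mul1mx.
have -> : (Gam i x)^T *m G x = (G x *m Gam i x)^T by rewrite trmx_mul symG.
rewrite GG; apply/matrixP => l j; rewrite !mxE.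
rewrite (partial_metric_sym i j l Ux).
set a := partial i _ _; set b := partial j _ _; set c := partial l _ _.
by field.
Qed.

Lemma partial_inv_metric i x : U x ->
  partial_mx i h x = - (Gam i x *m h x + h x *m (Gam i x)^T).
Proof.
move=> Ux; rewrite (partial_invmx oU i Ux smoothG unitG); congr (- _).
rewrite partial_metric // mulmxDr mulmxDl -/(h x); congr (_ + _).
  by rewrite mulmxA mulVmx ?unitG // mul1mx.
by rewrite -!mulmxA mulmxV ?unitG // mulmx1.
Qed.

(** The curvature form, exterior derivative of the connection plus its wedge square, evaluated on
    two coordinate fields; that is, the matrix of the endomorphism R(d_i, d_j). *)
Definition curvature i j x : 'M[R]_n :=
  partial_mx i (Gam j) x - partial_mx j (Gam i) x
  + (Gam i x *m Gam j x - Gam j x *m Gam i x).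

Lemma curvatureE i j l k x : curvature i j x l k = riemann G l k i j x.
Proof.
rewrite /curvature /riemann !mxE -sumrB; congr (_ + _).
  by congr (partial _ _ x - partial _ _ x); apply/funext => y; rewrite mxE.
by apply: eq_bigr => m _; rewrite !mxE.
Qed.

(* The Ricci identity applied to the parallel tensor [h]. *)
Lemma curvature_skew i j x : U x ->
  curvature i j x *m h x + h x *m (curvature i j x)^T = 0.
Proof.
move=> Ux.
have sh := smooth_inv_metric; have sG := smooth_connection.
have D2 k l : partial_mx k (partial_mx l h) x =
   - (partial_mx k (Gam l) x *m h x
        - Gam l x *m (Gam k x *m h x + h x *m (Gam k x)^T)
      + (h x *m (partial_mx k (Gam l) x)^T
         - (Gam k x *m h x + h x *m (Gam k x)^T) *m (Gam l x)^T)).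
  rewrite (@partial_mx_congr _ _ _ oU k _ _ _
    (fun y => - (Gam l y *m h y + h y *m (Gam l y)^T)) _ Ux); last first.
    by move=> y; exact: partial_inv_metric.
  have s3 := smooth_mx_tr (sG l).
  have s1 := smooth_mxM oU (sG l) sh; have s2 := smooth_mxM oU sh s3.
  rewrite (partial_mxN _ Ux (smooth_mxD oU s1 s2)) (partial_mxD _ Ux s1 s2).
  rewrite (partial_mxM _ Ux (sG l) sh) (partial_mxM _ Ux sh s3).
  rewrite partial_mx_tr partial_inv_metric // mulmxN mulNmx.
  by congr (- (_ + _)); rewrite addrC.
have := partial_mx_comm oU i j Ux sh; rewrite !D2 => /oppr_inj/eqP.
rewrite -subr_eq0 => /eqP E.
by rewrite -[RHS]E; exact: curvature_skew_identity.
Qed.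

Context {f : V -> R} (smoothf : smooth_on U f).

Local Notation H := (hessian G f).
Local Notation g := (gradient f).

Lemma smooth_gradient u : smooth_on U u -> smooth (gradient u).
Proof.
move=> su a b; under [X in smooth_on _ X]funext do rewrite mxE.
exact: smooth_on_partial.
Qed.

Lemma row_hessian u i x :
  row i (hessian G u x) = partial_mx i (gradient u) x - gradient u x *m Gam i x.
Proof.
apply/rowP => j; rewrite !mxE; congr (_ - _).
  by congr (partial _ _ x); apply/funext => y; rewrite mxE.
by apply: eq_bigr => k _; rewrite !mxE mulrC.
Qed.

Lemma hessian_sym u x : smooth_on U u -> U x ->
  (hessian G u x)^T = hessian G u x.
Proof.
move=> su Ux; apply/matrixP => i j; rewrite !mxE.
rewrite (partial_comm i j oU Ux (su 2%N)); congr (_ - _).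
apply: eq_bigr => k _; congr (_ * _).
by have := connection_sym i j k Ux; rewrite !mxE.
Qed.

Lemma smooth_hessian u : smooth_on U u -> smooth (hessian G u).
Proof.
move=> su i j; under [X in smooth_on _ X]funext do rewrite mxE.
apply: smooth_onB => //; first by do 2 apply: smooth_on_partial.
apply: smooth_on_sum => // k; apply: smooth_onM => //.
  have := smooth_connection i k j.
  by under [X in smooth_on _ X -> _]funext do rewrite mxE.
exact: smooth_on_partial.
Qed.

Lemma laplacian_trace u x : smooth_on U u -> U x ->
  laplacian G u x = \tr (h x *m hessian G u x).
Proof.
move=> su Ux; apply: eq_bigr => i _; rewrite mxE.
apply: eq_bigr => j _; congr (_ * _).
by rewrite -[in LHS](hessian_sym su Ux) mxE.
Qed.

(** The gradient vector field, whereas [gradient] is the row of partial derivatives, that is, the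
    differential. *)
Definition raised_grad x : V := g x *m h x.
Local Notation X := raised_grad.

Lemma smooth_raised_grad : smooth X.
Proof.
apply: smooth_mxM => //; [exact: smooth_gradient|exact: smooth_inv_metric].
Qed.

Lemma partial_gradient i x : partial_mx i g x = row i (H x) + g x *m Gam i x.
Proof. by rewrite row_hessian subrK. Qed.

Lemma partial_raised_grad i x : U x ->
  partial_mx i X x = row i (H x) *m h x - X x *m (Gam i x)^T.
Proof.
move=> Ux.
rewrite (partial_mxM _ Ux (smooth_gradient smoothf) smooth_inv_metric).
rewrite partial_gradient partial_inv_metric // /X mulmxN mulmxDl mulmxDr !mulmxA.
by rewrite opprD addrA addrK.
Qed.

Definition grad_sq x : R := quad (h x) (g x).
Local Notation Q := grad_sq.

Lemma smooth_grad_sq : smooth_on U Q.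
Proof.
have := smooth_mxM oU smooth_raised_grad
  (smooth_mx_tr (smooth_gradient smoothf)).
exact.
Qed.

(** The connection terms from differentiating the vector [X] and the covector [g] cancel, and the
    two Hessian terms that remain are equal by symmetry. *)
Lemma gradient_grad_sq x : U x -> gradient Q x = 2 *: (X x *m H x).
Proof.
move=> Ux; apply/rowP => i; rewrite mxE.
transitivity (partial_mx i (fun y => X y *m (g y)^T) x 0 0).
  by rewrite mxE.
have sX := smooth_raised_grad; have sg := smooth_gradient smoothf.
rewrite (partial_mxM _ Ux sX (smooth_mx_tr sg)).
rewrite partial_mx_tr partial_gradient partial_raised_grad //.
have XT : (X x)^T = h x *m (g x)^T by rewrite trmx_mul sym_inv_metric.
rewrite mulmxBl -[row i (H x) *m h x *m _]mulmxA -XT.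
rewrite trmxD [(g x *m Gam i x)^T]trmx_mul mulmxDr [X x *m (_ *m _)]mulmxA.
rewrite addrACA addNr addr0.
have -> : row i (H x) *m (X x)^T = (X x *m (row i (H x))^T)^T.
  by rewrite [RHS]trmx_mul trmxK.
have -> : X x *m (row i (H x))^T = ((X x *m H x) 0 i)%:M.
  rewrite tr_row hessian_sym // [LHS]mx11_scalar; congr (_%:M).
  by rewrite !mxE; apply: eq_bigr => k _; congr (_ * _); exact: mxE.
by rewrite tr_scalar_mx !mxE eqxx !mulr1n; ring.
Qed.

(** The covariant derivative of the Hessian in the [i]-th direction. *)
Definition cov_hessian i x :=
  partial_mx i H x - H x *m Gam i x - (Gam i x)^T *m H x.
Local Notation T := cov_hessian.

Lemma cov_hessian_sym i x : U x -> (T i x)^T = T i x.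
Proof.
move=> Ux; rewrite /T !(linearB, linearD) /= !trmx_mul trmxK hessian_sym //.
rewrite -partial_mx_tr addrAC.
by rewrite (partial_mx_congr oU i Ux (B := H)) // => y; exact: hessian_sym.
Qed.

(** The Ricci identity for the differential of [f]: commuting two covariant derivatives costs a
    curvature term. *)
Lemma cov_hessian_comm i k x : U x ->
  row k (T i x) - row i (T k x) = - (g x *m curvature i k x).
Proof.
move=> Ux; have sg := smooth_gradient smoothf.
have rT a b : row a (T b x) =
    partial_mx b (partial_mx a g) x
    - (row b (H x) + g x *m Gam b x) *m Gam a x - g x *m partial_mx b (Gam a) x
    - row a (H x) *m Gam b x - \sum_m Gam b x m a *: row m (H x).
  rewrite /T !linearB /= row_mul; congr (_ - _ - _).
    transitivity (partial_mx b (fun y => partial_mx a g y - g y *m Gam a y) x).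
      apply/rowP => j; rewrite !mxE; congr (partial _ _ x); apply/funext => y.
      by rewrite -row_hessian [RHS]mxE.
    have sc := smooth_connection a; have sgc := smooth_mxM oU sg sc.
    rewrite (partial_mxD _ Ux (smooth_partial_mx a sg) (smooth_mxN oU sgc)).
    rewrite (partial_mxN _ Ux sgc) (partial_mxM _ Ux sg sc).
    by rewrite partial_gradient opprD addrA.
  apply/rowP => j; rewrite !mxE summxE; apply: eq_bigr => m _.
  by rewrite !mxE.
rewrite !rT (partial_mx_comm oU i k Ux sg).
(* Absence of torsion: the connection is symmetric in its lower indices, so this term is the same on
   both sides. *)
have -> : \sum_m Gam i x m k *: row m (H x) = \sum_m Gam k x m i *: row m (H x).
  by apply: eq_bigr => m _; rewrite connection_sym.
exact: curvature_comm_identity.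
Qed.

(** The inverse metric is parallel, so the trace commutes with covariant differentiation. *)
Lemma partial_laplacian k x : U x ->
  partial k (laplacian G f) x = \tr (h x *m T k x).
Proof.
move=> Ux; have sh := smooth_inv_metric; have sH := smooth_hessian smoothf.
rewrite (@partial_congr _ _ U _ (fun y => \tr (h y *m H y)) _ _
  oU Ux); last first.
  by move=> y Uy; exact: laplacian_trace.
transitivity (\tr (partial_mx k (fun y => h y *m H y) x)).
  rewrite [X in partial k X](_ : _ = (fun y => \sum_i (h y *m H y) i i)) //.
  rewrite partial_sum; last first.
    by move=> i; apply: smooth_on_derivable Ux; apply: smooth_mxM.
  by apply: eq_bigr => i _; rewrite mxE.
rewrite (partial_mxM _ Ux sh sH) partial_inv_metric //.
exact: trace_transport_identity.
Qed.

Lemma row_hessian_grad_sq i x : U x ->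
  row i (hessian G Q x) = 2 *: (row i (H x) *m h x *m H x + X x *m T i x).
Proof.
move=> Ux; have sX := smooth_raised_grad; have sH := smooth_hessian smoothf.
rewrite row_hessian gradient_grad_sq //.
rewrite (partial_mx_congr oU i Ux gradient_grad_sq).
rewrite (partial_mxZ _ _ Ux (smooth_mxM oU sX sH)) (partial_mxM _ Ux sX sH).
rewrite partial_raised_grad // -scalemxAl -scalerBr; congr (_ *: _).
exact: row_hessian_identity.
Qed.

Lemma hessian_sqr_trace x : U x ->
  \sum_i \sum_j h x i j * (row i (H x) *m h x *m H x) 0 j =
  \tr (h x *m H x *m h x *m H x).
Proof.
move=> Ux; pose A := H x *m h x *m H x.
have sA : A^T = A.
  by rewrite /A !trmx_mul hessian_sym // sym_inv_metric // mulmxA.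
have -> : h x *m H x *m h x *m H x = h x *m A by rewrite /A !mulmxA.
apply: eq_bigr => i _; rewrite [RHS]mxE.
apply: eq_bigr => j _; congr (_ * _).
by rewrite -!row_mul mxE -/A -[in LHS]sA mxE.
Qed.

(** Skewness of the curvature with respect to [h] moves it from the covector [g] to the vector [X].
    The sign so produced makes the sum over [i] a positive multiple of Ricci in [bochner]. *)
Lemma curvature_contraction x i k : U x ->
  \sum_j h x i j * (g x *m curvature i k x) 0 j =
  - \sum_p X x 0 p * riemann G i p i k x.
Proof.
move=> Ux; transitivity ((g x *m curvature i k x *m h x) 0 i).
  rewrite [RHS]mxE; apply: eq_bigr => j _; rewrite mulrC; congr (_ * _).
  by rewrite -[in LHS](sym_inv_metric Ux) mxE.
have /eqP := curvature_skew i k Ux; rewrite addr_eq0 => /eqP E.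
rewrite -mulmxA E mulmxN mulmxA [LHS]mxE -/(X x); congr (- _).
by rewrite [LHS]mxE; apply: eq_bigr => p _; rewrite [_^T _ _]mxE curvatureE.
Qed.

Theorem bochner x : U x ->
  laplacian G Q x = 2 * (\tr (h x *m H x *m h x *m H x)
    + \sum_k X x 0 k * partial k (laplacian G f) x
    + quad (ricci G x) (X x)).
Proof.
move=> Ux.
have subr_eq_opp (a b c : R) : a - b = - c -> a = b - c.
  by move/eqP; rewrite subr_eq addrC => /eqP.
have hessE i j : hessian G Q x i j =
    2 * ((row i (H x) *m h x *m H x) 0 j + (X x *m T i x) 0 j).
  have /rowP/(_ j) := row_hessian_grad_sq i Ux.
  by rewrite [X in X = _]mxE => ->; rewrite [LHS]mxE;
     congr (_ * _); rewrite mxE.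
transitivity (2 * (\sum_i \sum_j h x i j * (row i (H x) *m h x *m H x) 0 j
     + \sum_i \sum_j h x i j * (X x *m T i x) 0 j)).
  rewrite -big_split big_distrr; apply: eq_bigr => i _ /=.
  rewrite -big_split big_distrr; apply: eq_bigr => j _ /=.
  by rewrite hessE; ring.
rewrite hessian_sqr_trace // -[in RHS]addrA; congr (_ * (_ + _)).
(* Exchanging the two outer derivatives replaces the derivative in direction [i] by one along [X],
   whose trace is the derivative of the Laplacian; the commutator will contribute the Ricci term. *)
have TE i j : (X x *m T i x) 0 j =
    \sum_k X x 0 k * (T k x i j - (g x *m curvature i k x) 0 j).
  rewrite mxE; apply: eq_bigr => k _; congr (_ * _).
  have /rowP/(_ j) := cov_hessian_comm i k Ux.
  rewrite [X in X = _]mxE [row k _ 0 j]mxE [X in _ = X]mxE.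
  rewrite [X in _ + X]mxE [row i _ 0 j]mxE.
  exact: subr_eq_opp.
transitivity (\sum_k X x 0 k * (\sum_i \sum_j h x i j * T k x i j)
   - \sum_k X x 0 k * (\sum_i \sum_j h x i j * (g x *m curvature i k x) 0 j)).
  rewrite -sumrB.
  under eq_bigr => i _.
    under eq_bigr => j _ do rewrite TE big_distrr.
    rewrite exchange_big; over.
  rewrite exchange_big; apply: eq_bigr => k _ /=.
  rewrite -mulrBr -sumrB big_distrr; apply: eq_bigr => i _ /=.
  rewrite -sumrB big_distrr; apply: eq_bigr => j _ /=.
  by ring.
congr (_ + _).
  apply: eq_bigr => k _; congr (_ * _); rewrite partial_laplacian //.
  apply: eq_bigr => i _; rewrite mxE; apply: eq_bigr => j _; congr (_ * _).
  by rewrite -[in LHS](cov_hessian_sym k Ux) mxE.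
rewrite quadE -sumrN; apply: eq_bigr => k _.
under eq_bigr => i _ do rewrite curvature_contraction //.
rewrite sumrN mulrN opprK exchange_big big_distrr; apply: eq_bigr => p _ /=.
by rewrite [ricci G x k p]mxE -mulrA mulr_suml; congr (_ * _);
  apply: eq_bigr => i _; rewrite mulrC.
Qed.

End Bochner.

Arguments grad_sq {R n} G f x.
Arguments raised_grad {R n} G f x.

(** * The one-dimensional model *)

Section Model.
Context {R : realType} (a m : R).
Hypotheses (a_ge0 : 0 <= a) (a_lt_m : a < m).
Implicit Types s t u : R.

Let m_gt0 : 0 < m. Proof. exact: le_lt_trans a_lt_m. Qed.

(** The first positive zero of [model1]: it comes from the factor [cos (m * s)] because [a < m]. *)
Definition model_radius : R := pi / (2 * m).
Local Notation L := model_radius.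

Let lam := m ^+ 2 - a ^+ 2.
Let lam_gt0 : 0 < lam.
Proof. by rewrite subr_gt0 ltr_pXn2r ?nnegrE // ltW. Qed.

(** The antiderivative of [model1] vanishing at 0; the denominator m^2 - a^2 is the eigenvalue. *)
Definition model s :=
  (m * (cos (a * s) * sin (m * s)) - a * (sin (a * s) * cos (m * s))) / lam.
Definition model1 s := cos (a * s) * cos (m * s).
Definition model2 s :=
  - a * (sin (a * s) * cos (m * s)) - m * (cos (a * s) * sin (m * s)).
Definition model3 s :=
  2 * a * m * (sin (a * s) * sin (m * s))
  - (a ^+ 2 + m ^+ 2) * (cos (a * s) * cos (m * s)).

Let dcos (b s : R) :
  is_derive s (1 : R) (fun s => cos (b * s)) (- b * sin (b * s)).
Proof.
have -> : - b * sin (b * s) = - sin (b * s) * (b *: 1).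
  by rewrite [b *: 1]mulr1 mulNr mulrC mulNr.
by apply: (@is_derive1_comp _ cos (fun s => b *: s)).
Qed.

Let dsin (b s : R) :
  is_derive s (1 : R) (fun s => sin (b * s)) (b * cos (b * s)).
Proof.
have -> : b * cos (b * s) = cos (b * s) * (b *: 1).
  by rewrite [b *: 1]mulr1 mulrC.
by apply: (@is_derive1_comp _ sin (fun s => b *: s)).
Qed.

Let dmul (f g : R -> R) (df dg s : R) :
  is_derive s (1 : R) f df -> is_derive s (1 : R) g dg ->
  is_derive s (1 : R) (fun s => f s * g s) (df * g s + f s * dg).
Proof.
move=> hf hg; have -> : df * g s + f s * dg = f s *: dg + g s *: df.
  by rewrite addrC [df * _]mulrC.
exact: (@is_deriveM _ _ f g).
Qed.

Let dlin (c d : R) (f g : R -> R) (df dg s : R) :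
  is_derive s (1 : R) f df -> is_derive s (1 : R) g dg ->
  is_derive s (1 : R) (fun s => c * f s - d * g s) (c * df - d * dg).
Proof. by move=> hf hg; apply: (@is_deriveB _ _ _ (c *: f) (d *: g)). Qed.

Lemma is_derive_model s : is_derive s (1 : R) model (model1 s).
Proof.
have D := dlin m a (dmul (dcos a s) (dsin m s)) (dmul (dsin a s) (dcos m s)).
have -> : model = fun s => lam^-1 *
    (m * (cos (a * s) * sin (m * s)) - a * (sin (a * s) * cos (m * s))).
  by apply/funext => t; rewrite /model mulrC.
have -> : model1 s = lam^-1 * (m * (- a * sin (a * s) * sin (m * s)
     + cos (a * s) * (m * cos (m * s)))
     - a * (a * cos (a * s) * cos (m * s)
     + sin (a * s) * (- m * sin (m * s)))).
  rewrite /model1; apply: (mulfI (lt0r_neq0 lam_gt0)).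
  by rewrite mulVKf ?gt_eqF // /lam; ring.
exact: (is_deriveZ (lam^-1) D).
Qed.

Lemma is_derive_model1 s : is_derive s (1 : R) model1 (model2 s).
Proof.
have := dmul (dcos a s) (dcos m s); congr (is_derive _ _ _ _).
by rewrite /model2; ring.
Qed.

Lemma is_derive_model2 s : is_derive s (1 : R) model2 (model3 s).
Proof.
have := dlin (- a) m (dmul (dsin a s) (dcos m s)) (dmul (dcos a s) (dsin m s)).
by congr (is_derive _ _ _ _); rewrite /model3; ring.
Qed.

Lemma model3_continuous : continuous model3.
Proof.
have cc (b : R) (f : R -> R) : continuous f -> continuous (fun s => f (b * s)).
  move=> cf s; apply: (@continuous_comp _ _ _ (fun s => b * s) f); last exact: cf.
  exact: mulrl_continuous.
have Cc b := cc b _ (@continuous_cos R).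
have Cs b := cc b _ (@continuous_sin R).
move=> s; apply: cvgB; apply: cvgM; try exact: cvg_cst.
- by apply: cvgM; exact: Cs.
- by apply: cvgM; exact: Cc.
Qed.

Lemma ltr_norm_radius s : (`|s| < L) = (`|m * s| < pi / 2).
Proof.
rewrite normrM gtr0_norm // /L ltr_pdivlMr ?mulr_gt0 // ltr_pdivlMr //.
by congr (_ < _); ring.
Qed.

Lemma cos_m_gt0 s : `|s| < L -> 0 < cos (m * s).
Proof. by rewrite ltr_norm_radius ltr_norml => h; exact: cos_gt0_pihalf. Qed.

Lemma cos_a_gt0 s : `|s| < L -> 0 < cos (a * s).
Proof.
rewrite ltr_norm_radius => h; apply: cos_gt0_pihalf; rewrite -ltr_norml.
by apply: le_lt_trans h; rewrite !normrM ler_wpM2r // !ger0_norm // ltW.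
Qed.

Lemma model1_gt0 s : `|s| < L -> 0 < model1 s.
Proof. by move=> h; rewrite mulr_gt0 ?cos_a_gt0 ?cos_m_gt0. Qed.

Lemma model0 : model 0 = 0.
Proof. by rewrite /model !mulr0 sin0 !mulr0 mul0r mulr0 subrr mul0r. Qed.

Lemma modelN s : model (- s) = - model s.
Proof. by rewrite /model !mulrN !sinN !cosN; field; rewrite gt_eqF. Qed.

Lemma model2N s : model2 (- s) = - model2 s.
Proof. by rewrite /model2 !mulrN !sinN !cosN; ring. Qed.

Lemma model_lt s t : `|s| < L -> `|t| < L -> s < t -> model s < model t.
Proof.
rewrite !ltr_norml => /andP[s1 _] /andP[_ t2] st.
have cm : {within `[s, t], continuous model}.
  by apply: derivable_within_continuous => x _; case: (is_derive_model x).
have [c + E] := MVT st (fun x _ => is_derive_model x) cm.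
rewrite in_itv /= => /andP[sc ct].
rewrite -subr_gt0 E mulr_gt0 ?subr_gt0 // model1_gt0 // ltr_norml.
by rewrite (lt_trans s1) // (lt_trans ct).
Qed.

Lemma model_inj s t : `|s| < L -> `|t| < L -> model s = model t -> s = t.
Proof.
move=> sL tL st; have [lt|lt|//] := ltgtP s t.
  by have := model_lt sL tL lt; rewrite st ltxx.
by have := model_lt tL sL lt; rewrite st ltxx.
Qed.

Lemma sin_ge0_radius (b s : R) : 0 <= b <= m -> 0 <= s < L -> 0 <= sin (b * s).
Proof.
move=> /andP[b0 bm] /andP[s0 sL]; apply: sin_ge0_pi; rewrite mulr_ge0 //=.
have h : m * s < pi / 2.
  have := sL; rewrite -{1}[s]ger0_norm // ltr_norm_radius ger0_norm //.
  by apply: mulr_ge0 => //; exact: ltW.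
apply: (@le_trans _ _ (m * s)); first by rewrite ler_wpM2r.
apply: (le_trans (ltW h)).
by rewrite ler_pdivrMr // ler_peMr ?pi_ge0 // ler1n.
Qed.

(** Both factors are odd, so [0 <= s] is enough, and there all the sines and cosines are
    nonnegative. This gives the sign of [u * P1] in the touching argument. *)
Lemma model_mul_model2_le0 s : `|s| < L -> model s * model2 s <= 0.
Proof.
wlog s0 : s / 0 <= s => [th|sL].
  have [/th//|s0 sL] := leP 0 s.
  by have := th (- s); rewrite modelN model2N mulrNN normrN oppr_ge0 ltW //; apply.
have sL' : 0 <= s < L by rewrite s0 -[s]ger0_norm.
have Sa : 0 <= sin (a * s) by apply: sin_ge0_radius => //; rewrite a_ge0 ltW.
have Sm : 0 <= sin (m * s) by apply: sin_ge0_radius => //; rewrite lexx ltW.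
rewrite mulr_ge0_le0 //.
  have [->|s1] := eqVneq s 0; first by rewrite model0.
  have s_gt0 : 0 < s by rewrite lt_neqAle eq_sym s1.
  have L0 : `|0 : R| < L by rewrite normr0 (le_lt_trans _ sL).
  by rewrite -model0; exact/ltW/model_lt.
rewrite /model2 mulNr -opprD oppr_le0; apply: addr_ge0; apply: mulr_ge0 => //.
- by rewrite mulr_ge0 // ltW // cos_m_gt0.
- exact: ltW.
- by rewrite mulr_ge0 // ltW // cos_a_gt0.
Qed.

(** Inserting w'' = T w' - lambda w and its derivative reduces the left-hand side to (K - T') w'^2 =
    T^2 w'^2 / 2 with K = -2a^2. The factor cos(as) of w' clears the tangent in T, so the code only
    needs the Pythagorean identities. *)
Lemma model_riccati s :
  model2 s ^+ 2 - model1 s * model3 s + (- 2 * a ^+ 2 - lam) * model1 s ^+ 2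
  + lam * model s * model2 s = 2 * a ^+ 2 * (sin (a * s) * cos (m * s)) ^+ 2.
Proof.
rewrite [lam * model s]mulrC /model divfK ?gt_eqF // /model1 /model2 /model3 /lam.
have := cos2sin2 (a * s); have := cos2sin2 (m * s).
move: (sin _) (cos _) => Sm Cm; move: (sin _) (cos _) => Sa Ca.
by rewrite !expr2 => Em Ea; ring: Em Ea.
Qed.

Lemma model_surj s0 u : 0 <= s0 < L -> `|u| <= model s0 ->
  exists2 s, `|s| <= s0 & model s = u.
Proof.
move=> /andP[s00 s0L] us.
have cm : {within `[- s0, s0], continuous model}.
  by apply: derivable_within_continuous => x _; case: (is_derive_model x).
have [||c + cu] := @IVT _ model (- s0) s0 u _ cm; first by rewrite ge0_cp.
  by move: us; rewrite modelN ge_min le_max ler_norml => /andP[-> ->]; rewrite orbT.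
by rewrite in_itv /= -ler_norml; exists c.
Qed.

Definition model_range : set R := [set u | exists2 s, `|s| < L & model s = u].
Local Notation J := model_range.

(** [xget] picks the preimage, unique by [model_inj]; the default 0 outside [model_range] carries no
    meaning. *)
Definition model_inv u : R := xget 0 [set s | `|s| < L /\ model s = u].
Local Notation sigma := model_inv.

Lemma model_invK s : `|s| < L -> sigma (model s) = s.
Proof.
move=> sL; rewrite /model_inv; case: xgetP => [t _ [tL E]|/(_ s)[]//].
exact: model_inj E.
Qed.

Lemma model_invP u : J u -> `|sigma u| < L /\ model (sigma u) = u.
Proof. by move=> [s sL <-]; rewrite model_invK. Qed.

Definition slope u := model1 (sigma u).
(** The bound for the squared gradient at a point of value [u], namely w'^2 at w^-1(u).
    Differentiation in [u] divides by w', which gives 2w'' and then 2w'''/w' in the next two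
    definitions. *)
Definition barrier u := slope u ^+ 2.
Definition barrier1 u := 2 * model2 (sigma u).
Definition barrier2 u := 2 * (model3 (sigma u) * (slope u)^-1).

Lemma slope_gt0 u : J u -> 0 < slope u.
Proof. by move=> /model_invP[sL _]; exact: model1_gt0. Qed.

Lemma is_derive_model_inv u : J u -> is_derive u (1 : R) sigma (slope u)^-1.
Proof.
move=> Ju; have [sL {1}<-] := model_invP Ju.
apply: is_derive_inverse.
- have : \forall t \near sigma u, `|t| < L.
    have := @norm_continuous _ R (sigma u) => c.
    exact: (cvgr_lt _ c).
  by apply: filterS => t tL; exact: model_invK.
- near=> t; apply/differentiable_continuous/derivable1_diffP.
  by case: (is_derive_model t).
- exact: is_derive_model.
- by rewrite gt_eqF // slope_gt0.
Unshelve. all: by end_near. Qed.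

Lemma is_derive_barrier u : J u -> is_derive u (1 : R) barrier (barrier1 u).
Proof.
move=> Ju; have ds : is_derive u (1 : R) slope (model2 (sigma u) * (slope u)^-1).
  by apply: is_derive1_comp; [exact: is_derive_model1|exact: is_derive_model_inv].
have -> : barrier = fun v => slope v * slope v.
  by apply/funext => v; rewrite /barrier expr2.
have := dmul ds ds; congr (is_derive _ _ _ _).
by rewrite /barrier1; field; rewrite gt_eqF // slope_gt0.
Qed.

Lemma is_derive_barrier1 u : J u -> is_derive u (1 : R) barrier1 (barrier2 u).
Proof.
move=> Ju.
have d2 : is_derive u (1 : R) (fun v => model2 (sigma v))
    (model3 (sigma u) * (slope u)^-1).
  by apply: is_derive1_comp; [exact: is_derive_model2|exact: is_derive_model_inv].
exact: (is_deriveZ 2 d2).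
Qed.

Lemma barrier2_continuous u : J u -> {for u, continuous barrier2}.
Proof.
move=> Ju; have cs : {for u, continuous sigma}.
  apply/differentiable_continuous/derivable1_diffP.
  by case: (is_derive_model_inv Ju).
apply: cvgM; first exact: cvg_cst.
apply: cvgM; first exact: (continuous_comp cs (@model3_continuous _)).
apply: continuousV; first by rewrite gt_eqF // slope_gt0.
apply: (continuous_comp cs).
apply/differentiable_continuous/derivable1_diffP.
by case: (is_derive_model1 (sigma u)).
Qed.

Lemma barrier1_le0 u : J u -> u * barrier1 u <= 0.
Proof.
move=> /model_invP[sL {1}<-]; rewrite mulrCA pmulr_rle0 //.
exact: model_mul_model2_le0.
Qed.

Lemma barrier_riccati u : J u ->
  0 <= barrier1 u ^+ 2 / 4 - barrier u * barrier2 u / 2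
       + (- 2 * a ^+ 2 - lam) * barrier u + lam * u * barrier1 u / 2.
Proof.
move=> Ju; have s0 := slope_gt0 Ju; have [_ E] := model_invP Ju.
have := model_riccati (sigma u); rewrite E => Ric.
suff -> : barrier1 u ^+ 2 / 4 - barrier u * barrier2 u / 2
       + (- 2 * a ^+ 2 - lam) * barrier u + lam * u * barrier1 u / 2
   = 2 * a ^+ 2 * (sin (a * sigma u) * cos (m * sigma u)) ^+ 2.
  by rewrite mulr_ge0 ?sqr_ge0 // mulr_ge0 ?sqr_ge0.
rewrite -Ric /barrier1 /barrier2 /barrier -/(slope u).
by field; rewrite gt_eqF.
Qed.

End Model.

(** * Maximum principle *)

Lemma partialBZ (R : realType) n (u w : 'rV[R]_n -> R) (c : R) i x :
  derivable u x 'e_i -> derivable w x 'e_i ->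
  partial i (fun y => u y - c * w y) x = partial i u x - c * partial i w x.
Proof.
move=> du dw; have dcw : derivable (fun y => c * w y) x 'e_i.
  exact: (derivableM (derivable_cst c x _) dw).
rewrite [LHS](deriveB du dcw); congr (_ - _).
rewrite [LHS](partialM (derivable_cst c _ _) dw) [partial _ _ _]derive_cst.
by rewrite mul0r add0r.
Qed.

Section TestFunction.
Context {R : realType} {n : nat}.
Local Notation V := 'rV[R]_n.
Context {U : set V} (oU : open U) (G : V -> 'M[R]_n).
Hypothesis smoothG : @smooth_mx R n U n n G.
Hypothesis symG : forall x, U x -> (G x)^T = G x.
Hypothesis posG : forall x, U x -> posdef (G x).
Implicit Types (x y : V) (i j k : 'I_n).
Local Notation h := (inv_metric G).

(** At a critical point the Christoffel terms vanish, so the covariant Hessian is the matrix of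
    ordinary second derivatives. *)
Lemma laplacian_local_max u x : Ck_on 2 U u -> U x ->
  (forall y, U y -> u y <= u x) -> laplacian G u x <= 0.
Proof.
move=> Cu Ux ux; have [du ddu] := local_max_test oU Ux Cu ux.
have -> : laplacian G u x = \tr (h x *m (hess_mx u x)^T).
  apply: eq_bigr => i _; rewrite [RHS]mxE; apply: eq_bigr => j _.
  congr (_ * _); rewrite !mxE [X in _ - X]big1 ?subr0 // => k _.
  by rewrite du mulr0.
apply: trace_nonpos.
- exact: (sym_inv_metric symG Ux).
- by apply: posdef_invmx; [exact: symG|exact: posG].
- move=> X; rewrite (_ : quad _ X = quad (hess_mx u x) X) //.
  rewrite !quadE exchange_big; apply: eq_bigr => i _; apply: eq_bigr => j _.
  by rewrite [_^T _ _]mxE; ring.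
Qed.

Context (J : set R) (phi phi1 phi2 : R -> R).
Hypothesis dphi : forall u, J u -> is_derive u (1 : R) phi (phi1 u).
Hypothesis dphi1 : forall u, J u -> is_derive u (1 : R) phi1 (phi2 u).
Hypothesis cphi2 : forall u, J u -> {for u, continuous phi2}.
Context (q f : V -> R) (c : R).
Hypotheses (smoothq : smooth_on U q) (smoothf : smooth_on U f).
Hypothesis fJ : forall x, U x -> J (f x).

(** [q] will be the squared gradient of [f], and [c] the constant for which the two terms touch. The
    regularity claimed below stops at C^2 because [phi2] is only assumed continuous. *)
Definition test_function x := q x - c * phi (f x).
Local Notation F := test_function.

Let cphi2f : Ck_on 0 U (fun x => phi2 (f x)).
Proof.
split=> // x Ux; apply: (@continuous_comp _ _ _ f phi2); last exact/cphi2/fJ.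
exact: (Ck_on_continuous (smoothf 0%N)).
Qed.

Let C1phi1f : Ck_on 1 U (fun x => phi1 (f x)).
Proof. exact: (Ck_on_comp oU fJ dphi1 (smoothf 1%N) cphi2f). Qed.

Let C2phif : Ck_on 2 U (fun x => phi (f x)).
Proof. exact: (Ck_on_comp oU fJ dphi (smoothf 2%N) C1phi1f). Qed.

Lemma Ck_on_test_function : Ck_on 2 U F.
Proof.
have := Ck_onD oU (smoothq 2%N) (Ck_onM oU (@Ck_on_cst _ _ 2 U (- c)) C2phif).
by apply: Ck_on_congr => // y _; rewrite /test_function mulNr.
Qed.

Lemma partial_scalar_comp (psi psi1 : R -> R) i x : U x ->
  (forall u, J u -> is_derive u (1 : R) psi (psi1 u)) ->
  is_derive x ('e_i : V) (fun y => psi (f y)) (psi1 (f x) * partial i f x).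
Proof.
move=> Ux dpsi; apply: derive_scalar_comp; first exact/dpsi/fJ.
exact: smooth_on_derivable smoothf Ux.
Qed.

Lemma partial_test_function i x : U x ->
  partial i F x = partial i q x - c * (phi1 (f x) * partial i f x).
Proof.
move=> Ux; have dq : derivable q x 'e_i := smooth_on_derivable smoothq Ux.
have [dp pE] := partial_scalar_comp i Ux dphi.
by rewrite (partialBZ _ dq dp); congr (_ - _ * _).
Qed.

Lemma hessian_test_function i j x : U x ->
  hessian G F x i j = hessian G q x i j
    - c * (phi1 (f x) * hessian G f x i j
           + phi2 (f x) * partial i f x * partial j f x).
Proof.
move=> Ux; rewrite !mxE.
have -> : partial i (partial j F) x = partial i (partial j q) x
    - c * (phi1 (f x) * partial i (partial j f) x
           + phi2 (f x) * partial i f x * partial j f x).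
  rewrite (partial_congr i oU Ux (partial_test_function j)).
  have dq : derivable (partial j q) x 'e_i :=
    smooth_on_derivable (smooth_on_partial j smoothq) Ux.
  have df : derivable (partial j f) x 'e_i :=
    smooth_on_derivable (smooth_on_partial j smoothf) Ux.
  have [dp pE] := partial_scalar_comp i Ux dphi1.
  have dpf := derivableM dp df.
  rewrite (partialBZ _ dq dpf) (partialM dp df).
  have -> : partial i (fun y => phi1 (f y)) x = phi2 (f x) * partial i f x.
    exact: pE.
  by rewrite [X in _ = _ - _ * X]addrC.
under eq_bigr => k _ do rewrite partial_test_function //.
have -> : \sum_k christoffel G k i j x *
      (partial k q x - c * (phi1 (f x) * partial k f x)) =
    \sum_k christoffel G k i j x * partial k q x
    - c * (phi1 (f x) * \sum_k christoffel G k i j x * partial k f x).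
  rewrite !big_distrr -sumrB; apply: eq_bigr => k _ /=.
  move: (christoffel _ _ _ _ _) (partial _ _ _) (partial _ _ _) => C p p'.
  by ring.
move: (\sum_k _) (\sum_k _) (partial _ _ _) (partial _ (partial _ _) _) => s s' p p'.
move: (partial i (partial j f) x) (partial i f x) (partial j f x) => r r' r''.
by ring.
Qed.

Lemma laplacian_test_function x : U x ->
  laplacian G F x = laplacian G q x
    - c * (phi1 (f x) * laplacian G f x + phi2 (f x) * grad_sq G f x).
Proof.
move=> Ux; rewrite /grad_sq quadE.
rewrite /laplacian !big_distrr -big_split big_distrr -sumrB.
apply: eq_bigr => i _ /=; rewrite !big_distrr -big_split big_distrr -sumrB.
apply: eq_bigr => j _ /=; rewrite hessian_test_function //.
rewrite [gradient f x 0 i]mxE [gradient f x 0 j]mxE -/(h x).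
move: (hessian _ _ _ _ _) (hessian _ _ _ _ _) (h x i j) => a b d.
move: (partial _ _ _) (partial _ _ _) => e e'.
by ring.
Qed.

End TestFunction.

(** Expansion of the squared norm of [H] minus a multiple of [g] tensor [g]. Cyclicity of the trace
    turns the cross terms into the value of [H] at [X] and the last term into the fourth power of
    the norm of [g]. *)
Lemma trace_rank_one (R : comNzRingType) n (h H : 'M[R]_n)
    (g : 'rV[R]_n) (b : R) :
  h^T = h ->
  let X := g *m h in
  \tr (h *m (H - b *: (g^T *m g)) *m h *m (H - b *: (g^T *m g))) =
  \tr (h *m H *m h *m H) - 2 * b * (X *m H *m X^T) 0 0
  + b ^+ 2 * (X *m g^T) 0 0 ^+ 2.
Proof.
move=> sh X; have XT : X^T = h *m g^T by rewrite trmx_mul sh.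
have tr11 (A : 'M[R]_1) : \tr A = A 0 0 by rewrite /mxtrace big_ord1.
have t1 : \tr (h *m H *m h *m (g^T *m g)) = (X *m H *m X^T) 0 0.
  by rewrite -tr11 mulmxA mxtrace_mulC XT !mulmxA.
have t2 : \tr (h *m (g^T *m g) *m h *m H) = (X *m H *m X^T) 0 0.
  by rewrite -tr11 XT -!mulmxA mxtrace_mulC -!mulmxA mxtrace_mulC !mulmxA.
have t3 : \tr (h *m (g^T *m g) *m h *m (g^T *m g)) = (X *m g^T) 0 0 ^+ 2.
  rewrite mulmxA mxtrace_mulC !mulmxA -/X -!mulmxA !mulmxA tr11.
  by rewrite -[X *m g^T *m g *m h *m g^T]mulmxA -[X *m g^T *m g *m _]mulmxA
     [g *m _]mulmxA -/X mxE big_ord1 expr2.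
have trB (A B : 'M[R]_n) : \tr (A - B) = \tr A - \tr B.
  by rewrite mxtraceD [\tr (- _)]raddfN.
pose E := g^T *m g; rewrite -/E in t1 t2 t3 *.
have -> : h *m (H - b *: E) *m h *m (H - b *: E) =
    (h *m H *m h *m H - b *: (h *m H *m h *m E))
    - b *: (h *m E *m h *m H - b *: (h *m E *m h *m E)).
  rewrite [h *m (H - _)]mulmxBr -[h *m (b *: E)]scalemxAr mulmxBl -scalemxAl.
  rewrite !mulmxBl -!scalemxAl.
  by rewrite !mulmxBr -!scalemxAr.
rewrite trB mxtraceZ !trB !mxtraceZ t1 t2 t3; ring.
Qed.

(** Let e be the Riccati expression. After the bounds on [T] and [ric], what remains is c (2ce -
    (c-1)(2(K - lam)P + lam u P1)). The last bracket is negative since K - lam < 0 and u P1 <= 0, so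
    [1 < c] gives strictness. *)
Lemma touching_inequality (R : realFieldType) (c T ric P P1 P2 K lam u : R) :
  1 < c -> K <= 0 -> 0 < lam -> 0 < P -> u * P1 <= 0 ->
  0 <= P1 ^+ 2 / 4 - P * P2 / 2 + (K - lam) * P + lam * u * P1 / 2 ->
  c ^+ 2 * P1 ^+ 2 / 4 <= T -> K * (c * P) <= ric ->
  0 < 2 * (T + - lam * (c * P) + ric) - c * (P1 * (- lam * u) + P2 * (c * P)).
Proof.
move=> c1 K0 l0 P0 uP1; set e := (X in 0 <= X) => e0 hT hr.
have c0 : 0 < c := lt_trans ltr01 c1.
have A0 : (K - lam) * P < 0 by rewrite pmulr_llt0 //; lra.
have B0 : lam * (u * P1) <= 0 by rewrite pmulr_rle0.
have Z0 : 0 < 2 * (c * e) - (c - 1) * (2 * ((K - lam) * P) + lam * (u * P1)).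
  rewrite subr_gt0; apply: (@lt_le_trans _ _ 0).
    by rewrite pmulr_rlt0 ?subr_gt0 //; lra.
  by rewrite mulr_ge0 // mulr_ge0 // ltW.
rewrite -(pmulr_rgt0 _ c0) in Z0; apply: (lt_le_trans Z0).
rewrite -subr_ge0.
rewrite (_ : _ - _ = 2 * (T - c ^+ 2 * P1 ^+ 2 / 4) + 2 * (ric - K * (c * P))).
  by rewrite addr_ge0 // mulr_ge0 // subr_ge0.
by rewrite /e; field.
Qed.

(** * The squared gradient cannot touch a multiple c > 1 of the barrier *)

Section Touching.
Context {R : realType} {n : nat}.
Local Notation V := 'rV[R]_n.
Context {U : set V} (oU : open U) (G : V -> 'M[R]_n).
Hypothesis smoothG : @smooth_mx R n U n n G.
Hypothesis symG : forall x, U x -> (G x)^T = G x.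
Hypothesis posG : forall x, U x -> posdef (G x).
Context (K lam : R) (J : set R) (phi phi1 phi2 : R -> R).
Hypotheses (K_le0 : K <= 0) (lam_gt0 : 0 < lam).
Hypothesis ricK : forall x, U x -> forall X : V,
  K * quad (G x) X <= quad (ricci G x) X.
Hypothesis dphi : forall u, J u -> is_derive u (1 : R) phi (phi1 u).
Hypothesis dphi1 : forall u, J u -> is_derive u (1 : R) phi1 (phi2 u).
Hypothesis cphi2 : forall u, J u -> {for u, continuous phi2}.
Hypothesis phi_gt0 : forall u, J u -> 0 < phi u.
Hypothesis phi1_le0 : forall u, J u -> u * phi1 u <= 0.
Hypothesis riccati_ge0 : forall u, J u ->
  0 <= phi1 u ^+ 2 / 4 - phi u * phi2 u / 2 + (K - lam) * phi u
       + lam * u * phi1 u / 2.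
Context (f : V -> R).
Hypotheses (smoothf : smooth_on U f) (fJ : forall x, U x -> J (f x)).
Hypothesis eigenf : forall x, U x -> laplacian G f x = - lam * f x.

Lemma quad_raised_grad x : U x ->
  quad (G x) (raised_grad G f x) = grad_sq G f x.
Proof.
move=> Ux; have uG : G x \in unitmx by exact/posdef_unitmx/posG.
rewrite /quad /raised_grad /inv_metric mulmxKV //.
by rewrite trmx_mul trmx_inv symG // mulmxA.
Qed.

(** At the touching point the test function has its maximum 0, hence a nonpositive Laplacian, while
    the Bochner formula makes that Laplacian positive. *)
Lemma no_touching x c : U x -> 1 < c ->
  (forall y, U y -> grad_sq G f y <= c * phi (f y)) ->
  grad_sq G f x = c * phi (f x) -> False.
Proof.
move=> Ux c1 le_all eq_x; have c0 : 0 < c := lt_trans ltr01 c1.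
have sQ : smooth_on U (grad_sq G f).
  exact: (smooth_grad_sq oU smoothG posG smoothf).
pose F := test_function phi (grad_sq G f) f c.
have CF : Ck_on 2 U F.
  exact: (Ck_on_test_function oU dphi dphi1 cphi2 c sQ smoothf fJ).
have Fx y : U y -> F y <= F x.
  by move=> Uy; rewrite /F /test_function eq_x subrr subr_le0 le_all.
have lapF := laplacian_local_max oU symG posG CF Ux Fx.
have [dF _] := local_max_test oU Ux CF Fx.
have Jx := fJ Ux.
rewrite (laplacian_test_function oU G dphi dphi1 c sQ smoothf fJ Ux) in lapF.
rewrite (bochner oU smoothG symG posG smoothf Ux) in lapF.
have dlap k : partial k (laplacian G f) x = - lam * partial k f x.
  rewrite (partial_congr k oU Ux eigenf).
  have df : derivable f x 'e_k := smooth_on_derivable smoothf Ux.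
  rewrite [LHS](partialM (derivable_cst (- lam) _ _) df) [partial _ _ _]derive_cst.
  by rewrite mul0r add0r.
set X := raised_grad G f x in lapF; set g := gradient f x.
set h := inv_metric G x in lapF; set H := hessian G f x in lapF.
set Q := grad_sq G f x in lapF eq_x.
have XgQ : (X *m g^T) 0 0 = Q by [].
have sumX : \sum_k X 0 k * partial k (laplacian G f) x = - lam * Q.
  rewrite -XgQ mxE mulr_sumr; apply: eq_bigr => k _.
  by rewrite dlap !mxE; ring.
have Ric : K * Q <= quad (ricci G x) X.
  by rewrite /Q -(quad_raised_grad Ux); exact: ricK.
(* The test function is critical at [x], so the Hessian sends the gradient to a multiple of itself;
   this determines its component along [g]. *)
have XH : 2 *: (X *m H) = (c * phi1 (f x)) *: g.
  rewrite -(gradient_grad_sq oU smoothG symG posG smoothf Ux).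
  apply/rowP => i; have := dF i.
  rewrite (partial_test_function dphi c sQ smoothf fJ) // !mxE => /eqP.
  by rewrite subr_eq0 mulrA => /eqP.
have XHX : 2 * (X *m H *m X^T) 0 0 = c * phi1 (f x) * Q.
  have sc (a : R) (A : 'M[R]_1) : (a *: A) 0 0 = a * A 0 0 by rewrite mxE.
  have := congr1 (fun A => (A *m X^T) 0 0) XH.
  rewrite /= -!scalemxAl !sc => ->; congr (_ * _).
  have -> : g *m X^T = (X *m g^T)^T by rewrite [RHS]trmx_mul trmxK.
  by rewrite mxE.
have sh : h^T = h by exact: (sym_inv_metric symG Ux).
have sH : H^T = H by exact: (hessian_sym oU symG smoothf Ux).
(* The touching point is not a critical point of [f], so division by [Q] is legitimate. *)
have Q0 : 0 < Q by rewrite eq_x mulr_gt0 // phi_gt0.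
(* [b *: (g^T *m g)] is the part of the Hessian along [g], the only one that
   is kept. *)
pose b := c * phi1 (f x) / (2 * Q).
have sB : (H - b *: (g^T *m g))^T = H - b *: (g^T *m g).
  by rewrite trmxD trmxN sH [(b *: _)^T]linearZ /= trmx_mul trmxK.
have := trace_sqr_ge0 sh (posdef_invmx (symG Ux) (posG Ux)) sB.
rewrite (trace_rank_one H g b sh) -/X XgQ.
have -> : 2 * b * (X *m H *m X^T) 0 0 = b * (2 * (X *m H *m X^T) 0 0) by ring.
rewrite XHX => tr_ge.
have {}tr_ge : c ^+ 2 * phi1 (f x) ^+ 2 / 4 <= \tr (h *m H *m h *m H).
  rewrite -subr_ge0; move: tr_ge; congr (0 <= _).
  by rewrite /b; field; rewrite gt_eqF.
have := touching_inequality c1 K_le0 lam_gt0 (phi_gt0 Jx) (phi1_le0 Jx)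
  (riccati_ge0 Jx) tr_ge.
rewrite -eq_x => /(_ _ Ric); rewrite -sumX -eigenf // => lap_gt0.
by have := lt_le_trans lap_gt0 lapF; rewrite ltxx.
Qed.

End Touching.

(** * Gradient estimate on the manifold *)

(* MathComp's [vector.coord] shadows the field of [chart]. *)
Local Notation coord := Defs.coord.

Section Charts.
Context {R : realType} {n : nat} (M : riemannian_manifold R n).
Local Notation V := 'rV[R]_n.
Implicit Types (c d : chart R n M) (p : M) (x y : V) (v : M -> R).
Local Notation atlas := (@rm_atlas R n M).
Local Notation metric := (@rm_metric R n M).

Lemma smooth_metric c : atlas c -> @smooth_mx R n (chart_cod c) n n (metric c).
Proof. by move=> ac i j; exact: rm_metric_smooth. Qed.

Lemma sym_metric c : atlas c ->
  forall x, chart_cod c x -> (metric c x)^T = metric c x.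
Proof. by move=> ac x; exact: rm_metric_sym. Qed.

Lemma posdef_metric c : atlas c ->
  forall x, chart_cod c x -> posdef (metric c x).
Proof. by move=> ac x cx X; exact: rm_metric_posdef. Qed.

Lemma overlap_open c d : open (overlap c d).
Proof.
rewrite openE => x [cx dx]; rewrite /interior; apply: filterI.
  by apply: open_nbhs_nbhs; split => //; exact: chart_cod_open.
apply: (param_continuous cx); apply: open_nbhs_nbhs; split => //.
exact: chart_dom_open.
Qed.

Lemma transition_cod c d x : overlap c d x -> chart_cod d (transition c d x).
Proof. by move=> [cx dx]; exact: coord_cod. Qed.

Lemma param_transition c d x : overlap c d x ->
  param d (transition c d x) = param c x.
Proof. by move=> [cx dx]; exact: coordK. Qed.

Lemma gradient_transition c d v x : atlas c -> atlas d -> smooth_function v ->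
  overlap c d x ->
  gradient (v \o param c) x =
  gradient (v \o param d) (transition c d x) *m transition_jacobian c d x.
Proof.
move=> ac ad sv ox; apply/rowP => i; rewrite mxE [RHS]mxE.
have oO := overlap_open (c := c) (d := d).
pose tau := transition c d.
have E y : overlap c d y -> (v \o param c) y = (v \o param d) (tau y).
  by move=> oy; rewrite /= param_transition.
rewrite (partial_congr i oO ox E).
(* Along this curve the chain rule for the transition map reduces to [is_derive_curve], using only
   partial derivatives of the components of [tau]. *)
pose gam (s : R) := tau (x + s *: 'e_i).
have g0 : gam 0 = tau x by rewrite /gam scale0r addr0.
have dtau a : derivable (fun y => tau y 0 a) (x + 0 *: 'e_i) 'e_i.
  rewrite scale0r addr0.
  exact: (smooth_on_derivable (rm_compatible ac ad a) ox).
have dgam : derivable gam 0 1.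
  apply/derivable_mxP => j a; rewrite ord1.
  exact: (@derivable_line _ _ (fun y => tau y 0 a) x 'e_i 0).
have df : differentiable (v \o param d) (gam 0).
  rewrite g0; apply: (@Ck_on_differentiable _ _ 0 (chart_cod d)).
  - exact: chart_cod_open.
  - exact: (sv d ad 1%N).
  - exact: transition_cod.
have := @is_derive_of_line _ _ ((v \o param d) \o tau) x 'e_i _
  (is_derive_curve df dgam).
move=> [_ pE]; rewrite [LHS]pE; apply: eq_bigr => a _.
rewrite g0 [X in _ = X * _]mxE mulrC; congr (_ * _).
rewrite derive1E (derive_mx dgam) mxE.
rewrite (@derive_line _ _ (fun y => tau y 0 a) x 'e_i 0) scale0r addr0.
by rewrite mxE.
Qed.

(** Invertibility of [J] is read off from that of the product, which in the application is a
    positive definite metric matrix. The identity is the transformation law of the inverse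
    metric. *)
Lemma invmx_congruence m (J A : 'M[R]_m) : J^T *m A *m J \in unitmx ->
  J *m invmx (J^T *m A *m J) *m J^T = invmx A.
Proof.
move=> u; have uJ : J \in unitmx by move: u; rewrite unitmx_mul => /andP[].
have uA : A \in unitmx.
  by move: u; rewrite !unitmx_mul => /andP[/andP[]].
set S := J^T *m A *m J in u *.
have uJT : J^T \in unitmx by rewrite unitmx_tr.
have AB : A *m (J *m invmx S *m J^T) = 1%:M.
  apply: (can_inj (mulKmx uJT)).
  by rewrite !mulmxA -/S mulmxV // mul1mx mulmx1.
by rewrite -[RHS]mulmx1 -AB mulKmx.
Qed.

Lemma grad_sq_transition c d v x : atlas c -> atlas d -> smooth_function v ->
  overlap c d x ->
  grad_sq (metric c) (v \o param c) x =
  grad_sq (metric d) (v \o param d) (transition c d x).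
Proof.
move=> ac ad sv ox; have cx := ox.1.
rewrite /grad_sq (gradient_transition ac ad sv ox).
set g := gradient _ _; have tE := rm_metric_tensor ac ad ox.
have u : metric c x \in unitmx by exact/posdef_unitmx/posdef_metric.
rewrite tE in u; rewrite /inv_metric tE -(invmx_congruence u).
by rewrite /quad trmx_mul !mulmxA.
Qed.

Definition chart_at p : chart R n M := projT1 (cid2 (rm_cover p)).

Lemma chart_atP p : atlas (chart_at p) /\ chart_dom (chart_at p) p.
Proof. by rewrite /chart_at; case: (cid2 _). Qed.

(** Computed in a chart picked by choice; [grad_norm2E] then allows any chart of the atlas. *)
Definition grad_norm2 v p : R :=
  grad_sq (metric (chart_at p)) (v \o param (chart_at p))
    (coord (chart_at p) p).

Lemma grad_norm2E v c x : smooth_function v -> atlas c -> chart_cod c x ->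
  grad_norm2 v (param c x) = grad_sq (metric c) (v \o param c) x.
Proof.
move=> sv ac cx; have [ad dp] := chart_atP (param c x).
by rewrite (grad_sq_transition ac ad sv).
Qed.

Lemma chart_continuous (w : M -> R) c p : chart_dom c p ->
  {for coord c p, continuous (w \o param c)} -> {for p, continuous w}.
Proof.
move=> cp cw.
have cc : {for p, continuous (coord c)} by exact: Defs.coord_continuous.
have cwc : {for p, continuous ((w \o param c) \o coord c)}.
  exact: (continuous_comp cc cw).
have E : \forall q \near p, ((w \o param c) \o coord c) q = w q.
  have : \forall q \near p, chart_dom c q.
    by apply: open_nbhs_nbhs; split => //; exact: chart_dom_open.
  by apply: filterS => q cq; rewrite /= coordK.
rewrite /prop_for /continuous_at -(nbhs_singleton E).
by apply: cvg_trans cwc; exact: near_eq_cvg.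
Qed.

Lemma smooth_function_continuous v : smooth_function v -> continuous v.
Proof.
move=> sv p; have [ac cp] := chart_atP p.
apply: (chart_continuous cp); apply: (Ck_on_continuous (sv _ ac 0%N)).
exact: coord_cod.
Qed.

Lemma grad_norm2_continuous v : smooth_function v -> continuous (grad_norm2 v).
Proof.
move=> sv p; have [ac cp] := chart_atP p; set c := chart_at p in ac cp.
apply: (chart_continuous cp); have cx := coord_cod cp.
apply: (@continuous_congr _ _ (chart_cod c)
    (grad_sq (metric c) (v \o param c))) => //.
- exact: chart_cod_open.
- by move=> y cy; rewrite /= grad_norm2E.
- have sQ := smooth_grad_sq (@chart_cod_open _ _ _ c) (smooth_metric ac)
    (posdef_metric ac) (sv c ac).
  exact: (Ck_on_continuous (sQ 0%N)).
Qed.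

Lemma closed_EVT_max (w : M -> R) (p0 : M) :
  closed_manifold M -> continuous w -> exists p, forall q, w q <= w p.
Proof.
move=> [cM _] cw; have [|p _ pP] := compact_EVT_max _ cM (continuous_subspaceT cw).
  by exists p0.
by exists p => q; apply: pP; rewrite inE.
Qed.

Lemma laplacian_at_max v c x : atlas c -> chart_cod c x -> smooth_function v ->
  (forall q, v q <= v (param c x)) ->
  laplacian (metric c) (v \o param c) x <= 0.
Proof.
move=> ac cx sv vx.
apply: (@laplacian_local_max _ _ _ (@chart_cod_open _ _ _ c) _
    (sym_metric ac) (posdef_metric ac)) => // [|y _]; last exact: vx.
exact: (sv c ac 2%N).
Qed.

(** * The pointwise gradient bound *)

Section GradientEstimate.
Context (K lam : R) (J : set R) (phi phi1 phi2 : R -> R) (v : M -> R).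
Hypotheses (K_le0 : K <= 0) (lam_gt0 : 0 < lam).
Hypothesis dphi : forall u, J u -> is_derive u (1 : R) phi (phi1 u).
Hypothesis dphi1 : forall u, J u -> is_derive u (1 : R) phi1 (phi2 u).
Hypothesis cphi2 : forall u, J u -> {for u, continuous phi2}.
Hypothesis phi_gt0 : forall u, J u -> 0 < phi u.
Hypothesis phi1_le0 : forall u, J u -> u * phi1 u <= 0.
Hypothesis riccati_ge0 : forall u, J u ->
  0 <= phi1 u ^+ 2 / 4 - phi u * phi2 u / 2 + (K - lam) * phi u
       + lam * u * phi1 u / 2.
Hypotheses (Mclosed : closed_manifold M) (ricK : ricci_ge M K).
Hypotheses (eigenv : eigenfunction lam v) (vJ : forall p, J (v p)).

(** The maximum [c] of the quotient is the least constant for which the bound times [c] holds on all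
    of M, with equality at [q]. A failure of the estimate would give [1 < c], which [no_touching]
    excludes in a chart around [q]. *)
Theorem gradient_estimate p : grad_norm2 v p <= phi (v p).
Proof.
have [sv _ lapv] := eigenv.
have cv := smooth_function_continuous sv.
have cphi u : J u -> {for u, continuous phi}.
  move=> Ju; apply/differentiable_continuous/derivable1_diffP.
  by case: (dphi Ju).
have cq : continuous (fun q => grad_norm2 v q / phi (v q)).
  move=> q; apply: cvgM; first exact: grad_norm2_continuous.
  apply: (@continuousV _ _ (phi \o v)); first by rewrite gt_eqF // phi_gt0.
  by apply: continuous_comp; [exact: cv|exact: cphi].
have [q qmax] := closed_EVT_max p Mclosed cq.
rewrite leNgt; apply/negP => lt_p.
set c := grad_norm2 v q / phi (v q) in qmax.
have le_all r : grad_norm2 v r <= c * phi (v r).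
  by rewrite -ler_pdivrMr ?phi_gt0.
have c1 : 1 < c.
  apply: lt_le_trans (qmax p).
  by rewrite ltr_pdivlMr ?phi_gt0 // mul1r.
have [ad dq] := chart_atP q; set d := chart_at q in ad dq.
have dx := coord_cod dq; have qE := coordK dq.
apply: (@no_touching _ _ _ (@chart_cod_open _ _ _ d) _ (smooth_metric ad)
  (sym_metric ad) (posdef_metric ad) K lam J phi phi1 phi2 K_le0 lam_gt0 _ dphi
  dphi1 cphi2 phi_gt0 phi1_le0 riccati_ge0 (v \o param d) (sv d ad) _ _
  (coord d q) c dx c1).
- by move=> x ddx X; exact: ricK.
- by move=> x _; exact: vJ.
- by move=> x ddx; exact: lapv.
- by move=> y dy; rewrite -grad_norm2E //; exact: le_all.
- by rewrite -grad_norm2E // /= qE /c divfK // gt_eqF // phi_gt0.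
Qed.

End GradientEstimate.
End Charts.

(** * Length and distance *)

Lemma quad_cauchy_schwarz (R : realType) n (A : 'M[R]_n) (Y g : 'rV[R]_n) :
  A^T = A -> posdef A ->
  (\sum_i Y 0 i * g 0 i) ^+ 2 <= quad A Y * quad (invmx A) g.
Proof.
move=> sA pA; have uA := posdef_unitmx pA.
have YgE : \sum_i Y 0 i * g 0 i = (Y *m g^T) 0 0.
  by rewrite mxE; apply: eq_bigr => i _; rewrite mxE.
rewrite YgE; have [->|g0] := eqVneq g 0.
  by rewrite trmx0 mulmx0 /quad !mul0mx mxE expr2 !mulr0.
set b := (Y *m g^T) 0 0.
have q0 : 0 < quad (invmx A) g by exact: posdef_invmx.
set q := quad _ g in q0 *; pose X := g *m invmx A.
have XA : X *m A = g by rewrite /X mulmxKV.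
(* The value of [s] minimizing [quad A (Y - s *: X)]. *)
pose s := b / q.
have := posdef_quad_ge0 (Y - s *: X) pA.
suff -> : quad A (Y - s *: X) = quad A Y - 2 * s * b + s ^+ 2 * q.
  rewrite -(pmulr_lge0 _ q0).
  rewrite (_ : (_ + _) * q = quad A Y * q - b ^+ 2); first by rewrite subr_ge0.
  by rewrite /s; field; rewrite gt_eqF.
have sc (a : R) (B : 'M[R]_1) : (a *: B) 0 0 = a * B 0 0 by rewrite mxE.
have sd (B C : 'M[R]_1) : (B - C) 0 0 = B 0 0 - C 0 0 by rewrite !mxE.
have tr (B : 'M[R]_1) : B^T 0 0 = B 0 0 by rewrite mxE.
have t1 : (Y *m A *m X^T) 0 0 = b.
  by rewrite -mulmxA -{1}sA -trmx_mul XA.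
have t2 : (X *m A *m Y^T) 0 0 = b by rewrite XA -tr trmx_mul trmxK.
have t3 : (X *m A *m X^T) 0 0 = q.
  by rewrite XA trmx_mul trmx_inv sA /q /quad mulmxA.
rewrite /quad trmxD trmxN [(s *: X)^T]linearZ /=.
rewrite mulmxBr !mulmxBl -!scalemxAr -!scalemxAl scalerA.
rewrite !sd !sc t1 t2 t3 [X in _ = X - _ + _]/(quad A Y).
by ring.
Qed.

Section ArcLength.
Context {R : realType} {n : nat} (M : riemannian_manifold R n).
Local Notation V := 'rV[R]_n.
Implicit Types (c d : chart R n M) (p : M) (x y : V) (v : M -> R).
Local Notation atlas := (@rm_atlas R n M).
Local Notation metric := (@rm_metric R n M).
Local Notation mu := (@lebesgue_measure R).
Local Notation I01 := (`[0, 1]%classic : set R).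

Definition speed c (gam : R -> V) t :=
  Num.sqrt (quad (metric c (gam t)) (derive1 gam t)).

Lemma in01E (t : R) : I01 t -> 0 <= t <= 1.
Proof. by rewrite /= in_itv. Qed.

Lemma derivable_continuous (gam : R -> V) t :
  derivable gam t 1 -> {for t, continuous gam}.
Proof. by move=> /derivable1_diffP /differentiable_continuous. Qed.

Lemma within01 (T : topologicalType) (f : R -> T) :
  (forall t, 0 <= t <= 1 -> {for t, continuous f}) ->
  {within I01, continuous f}.
Proof.
by move=> cf; apply: continuous_in_subspaceT => t; rewrite inE => /in01E;
  exact: cf.
Qed.

Lemma curve_within (F : V -> R) (U : set V) (gam : R -> V) :
  C1_arc gam -> (forall t, 0 <= t <= 1 -> U (gam t)) ->
  Ck_on 0 U F -> {within I01, continuous (F \o gam)}.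
Proof.
move=> [dg _] gU CF; apply: within01 => t t01; apply: continuous_comp.
  exact/derivable_continuous/dg.
exact: (Ck_on_continuous CF (gU t t01)).
Qed.

Lemma velocity_within (gam : R -> V) i : C1_arc gam ->
  {within I01, continuous (fun t => derive1 gam t 0 i)}.
Proof.
move=> [_ cg] t; apply: (@continuous_comp (subspace I01) _ _ (derive1 gam)
  (fun x : V => x 0 i)).
  exact: cg.
exact: coord_continuous.
Qed.

Lemma speed_within c (gam : R -> V) : atlas c -> C1_arc gam ->
  (forall t, 0 <= t <= 1 -> chart_cod c (gam t)) ->
  {within I01, continuous (speed c gam)}.
Proof.
move=> ac Cg gc t; apply: (@continuous_comp (subspace I01) _ _
  (fun t => quad (metric c (gam t)) (derive1 gam t)) Num.sqrt); last first.
  exact: sqrt_continuous.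
rewrite (_ : (fun t => _) = fun t => \sum_i \sum_j
   derive1 gam t 0 i * metric c (gam t) i j * derive1 gam t 0 j); last first.
  by apply/funext => s; rewrite quadE.
apply: (continuous_rsum (T := subspace I01)) => i.
apply: (continuous_rsum (T := subspace I01)) => j.
apply: (@continuousM _ (subspace I01)); last exact: velocity_within.
apply: (@continuousM _ (subspace I01)); first exact: velocity_within.
exact: (curve_within Cg gc (smooth_metric ac i j 0%N)).
Qed.

Lemma integrable01 (f : R -> R) : {within I01, continuous f} ->
  mu.-integrable I01 (EFin \o f).
Proof.
move=> cf; apply: continuous_compact_integrable => //.
exact: segment_compact.
Qed.

Lemma FTC_bound (F f k : R -> R) :
  (forall t : R, 0 <= t <= 1 -> is_derive t (1 : R) F (f t)) ->
  {within I01, continuous f} -> {within I01, continuous k} ->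
  (forall t, 0 <= t <= 1 -> `|f t| <= k t) ->
  `|F 1 - F 0| <= Rintegral mu I01 k.
Proof.
move=> dF cf ck fk.
have cF t : 0 <= t <= 1 -> {for t, continuous F}.
  move=> t01; apply/differentiable_continuous/derivable1_diffP.
  by case: (dF t t01).
have FE : Rintegral mu I01 f = F 1 - F 0.
  rewrite /Rintegral (@continuous_FTC2 _ f F 0 1) //.
    split.
    - move=> t; rewrite in_itv /= => /andP[t0 t1].
      by case: (dF t); rewrite ?(ltW t0) ?(ltW t1).
    - by apply: cvg_at_right_filter; apply: cF; rewrite lexx ler01.
    - by apply: cvg_at_left_filter; apply: cF; rewrite lexx ler01.
  move=> t; rewrite in_itv /= => /andP[t0 t1]; rewrite derive1E.
  by case: (dF t) => [|_ ->//]; rewrite (ltW t0) (ltW t1).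
have mI : measurable I01 by exact: measurable_itv.
have cnf : {within I01, continuous (fun t => `|f t|)}.
  move=> t; apply: (@continuous_comp (subspace I01) _ _ f (fun x : R => `|x|)).
    exact: cf.
  exact: norm_continuous.
rewrite -FE; apply: le_trans (le_normr_Rintegral _ _) _ => //.
  exact: integrable01.
by apply: le_Rintegral => //; exact: integrable01.
Qed.

Lemma arc_lengthE c gam : arc_length c gam = Rintegral mu I01 (speed c gam).
Proof. by []. Qed.

Lemma arc_length_ge0 c gam : 0 <= arc_length c gam.
Proof. by apply: Rintegral_ge0 => t _; exact: sqrtr_ge0. Qed.

Lemma joined_ge0 (p q : M) l : joined p q l -> 0 <= l.
Proof.
elim=> {p q l} // c gam q l ac Cg gc _ l0.
by rewrite addr_ge0 // arc_length_ge0.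
Qed.

Section Lipschitz.
Context (J : set R) (sigma rho : R -> R) (v : M -> R).
Hypothesis rho_gt0 : forall u, J u -> 0 < rho u.
Hypothesis dsigma : forall u, J u -> is_derive u (1 : R) sigma (rho u)^-1.
Hypothesis crho : forall u, J u -> {for u, continuous rho}.
Hypotheses (sv : smooth_function v) (vJ : forall p, J (v p)).
Hypothesis grad_le : forall p, grad_norm2 v p <= rho (v p) ^+ 2.

(** The derivative along the arc is the pairing of the velocity with the differential of [v],
    divided by [rho]. By Cauchy-Schwarz and the gradient bound it is at most the speed. *)
Lemma arc_lipschitz c gam : atlas c -> C1_arc gam ->
  (forall t, 0 <= t <= 1 -> chart_cod c (gam t)) ->
  `|sigma (v (param c (gam 1))) - sigma (v (param c (gam 0)))|
    <= arc_length c gam.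
Proof.
move=> ac Cg gc; have [dg _] := Cg; pose f := v \o param c.
pose psi t := (rho (f (gam t)))^-1 *
  \sum_i derive1 gam t 0 i * partial i f (gam t).
have sf : smooth_on (chart_cod c) f by exact: sv.
rewrite arc_lengthE; apply: (@FTC_bound (sigma \o (f \o gam)) psi).
- move=> t t01; apply: is_derive1_comp; first exact/dsigma/vJ.
  apply: is_derive_curve; last exact: dg.
  by apply: (Ck_on_differentiable (@chart_cod_open _ _ _ c) (sf 1%N));
    exact: gc.
- have c1 : {within I01, continuous (fun t => (rho (f (gam t)))^-1)}.
    move=> t; apply: (@continuousV _ (subspace I01)).
      by rewrite gt_eqF //; exact/rho_gt0/vJ.
    apply: (@continuous_comp (subspace I01) _ _ (f \o gam) rho).
      exact: (curve_within Cg gc (sf 0%N)).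
    exact/crho/vJ.
  have c2 : {within I01, continuous (fun t =>
      \sum_i derive1 gam t 0 i * partial i f (gam t))}.
    move=> t; apply: (continuous_rsum (T := subspace I01)) => i.
    apply: (@continuousM _ (subspace I01)); first exact: velocity_within.
    exact: (curve_within Cg gc (smooth_on_partial i sf 0%N)).
  by move=> t; exact: (@continuousM _ (subspace I01) _ _ t (c1 t) (c2 t)).
- exact: speed_within.
- move=> t t01; have ct := gc t t01.
  have r0 : 0 < rho (f (gam t)) by exact/rho_gt0/vJ.
  have A0 : 0 <= quad (metric c (gam t)) (derive1 gam t).
    exact/posdef_quad_ge0/posdef_metric.
  rewrite normrM gtr0_norm ?invr_gt0 // ler_pdivrMl //.
  have gE : \sum_i derive1 gam t 0 i * partial i f (gam t) =
      \sum_i derive1 gam t 0 i * gradient f (gam t) 0 i.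
    by apply: eq_bigr => i _; rewrite [gradient _ _ _ _]mxE.
  have := quad_cauchy_schwarz (derive1 gam t) (gradient f (gam t))
    (sym_metric ac ct) (posdef_metric ac ct).
  rewrite -gE -/(grad_sq (metric c) f (gam t)) -grad_norm2E //.
  set D := \sum_i _ => D_le.
  have := ler_wpM2l A0 (grad_le (param c (gam t))).
  move=> /(le_trans D_le) => {}D_le.
  rewrite /speed -sqrtr_sqr -[X in _ <= X * _](ger0_norm (ltW r0)) -sqrtr_sqr.
  rewrite -sqrtrM ?sqr_ge0 //; apply: ler_wsqrtr; rewrite mulrC.
  exact: D_le.
Qed.

Lemma joined_lipschitz (p q : M) l : joined p q l ->
  `|sigma (v p) - sigma (v q)| <= l.
Proof.
elim=> {p q l} [p|c gam q l ac Cg gc _ IH]; first by rewrite subrr normr0.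
apply: le_trans (ler_distD (sigma (v (param c (gam 1)))) _ _) _.
by rewrite lerD // distrC arc_lipschitz.
Qed.

End Lipschitz.

(** Straight in the coordinates of a chart, not a geodesic: a finite length is enough to compare
    nearby points. *)
Definition segment_curve x y (t : R) : V := x + t *: (y - x).

Lemma is_derive_segment x y t : is_derive t (1 : R) (segment_curve x y) (y - x).
Proof.
have d : is_derive t (1 : R) (fun s : R => s *: (y - x)) ((1 : R) *: (y - x)).
  have D : is_diff t (fun s : R => s *: (y - x)) (fun s : R => s *: (y - x)).
    exact: is_diff_scalel.
  apply: DeriveDef; first by apply/derivable1_diffP; exact: ex_diff.
  by rewrite deriveE ?diff_val //; exact: ex_diff.
have := is_deriveD (is_derive_cst x t (1 : R)) d.
by rewrite add0r scale1r.
Qed.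

Lemma C1_segment x y : C1_arc (segment_curve x y).
Proof.
have dE : derive1 (segment_curve x y) = fun=> y - x.
  by apply/funext => t; rewrite derive1E; case: (is_derive_segment x y t).
split; first by move=> t _; case: (is_derive_segment x y t).
by rewrite dE => t; exact: cst_continuous.
Qed.

End ArcLength.

(** * Finiteness and boundedness of the Riemannian distance *)

Section Distance.
Context {R : realType} {n : nat} (M : riemannian_manifold R n).
Local Notation V := 'rV[R]_n.
Implicit Types (c d : chart R n M) (p q : M) (x y : V) (S : set M).
Local Notation atlas := (@rm_atlas R n M).
Local Notation metric := (@rm_metric R n M).
Local Notation mu := (@lebesgue_measure R).

Lemma segment_curve0 x y : segment_curve x y 0 = x.
Proof. by rewrite /segment_curve scale0r addr0. Qed.

Lemma segment_curve1 x y : segment_curve x y 1 = y.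
Proof. by rewrite /segment_curve scale1r addrC subrK. Qed.

Lemma segment_in_ball x0 r x y t : ball x0 r x -> ball x0 r y ->
  0 <= t <= 1 -> ball x0 r (segment_curve x y t).
Proof.
rewrite -!ball_normE /= => xr yr /andP[t0 t1].
have -> : x0 - segment_curve x y t = (1 - t) *: (x0 - x) + t *: (x0 - y).
  rewrite /segment_curve scalerBl scale1r !scalerBr !opprD opprK.
  by apply/rowP => i; rewrite !mxE; ring.
have [->|tn0] := eqVneq t 0.
  by rewrite subr0 scale1r scale0r addr0.
apply: le_lt_trans (ler_normD _ _) _; rewrite !normrZ.
rewrite (ger0_norm t0) ger0_norm ?subr_ge0 //.
have t_gt0 : 0 < t by rewrite lt_neqAle eq_sym tn0.
have -> : r = (1 - t) * r + t * r by ring.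
by rewrite ler_ltD ?ltr_pM2l // ler_wpM2l ?subr_ge0 // ltW.
Qed.

Lemma metric_local_bound c x0 : atlas c -> chart_cod c x0 ->
  exists r C : R, 0 < r /\ forall x y, ball x0 r x -> ball x0 r y ->
    (forall t, 0 <= t <= 1 -> chart_cod c (segment_curve x y t)) /\
    arc_length c (segment_curve x y) <= C.
Proof.
move=> ac cx0.
pose B i j : R := `|metric c x0 i j| + 1.
have : \forall y \near x0, chart_cod c y /\
    forall ij : 'I_n * 'I_n, `|metric c y ij.1 ij.2| < B ij.1 ij.2.
  near=> y; split.
    by near: y; apply: open_nbhs_nbhs; split => //; exact: chart_cod_open.
  move=> ij; move: ij; near: y; apply: filter_forall => -[i j] /=.
  have cg : {for x0, continuous (fun y => `|metric c y i j|)}.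
    apply: (@continuous_comp _ _ _ (fun y => metric c y i j) (fun z : R => `|z|)).
      exact: (Ck_on_continuous (rm_metric_smooth ac i j 0%N)).
    exact: norm_continuous.
  by apply: (cvgr_lt _ cg); rewrite /B ltrDl.
move=> /nbhs_ballP[r /= r0 rP].
pose D : R := r + r.
exists r, (Num.sqrt (\sum_i \sum_j D * B i j * D)); split=> // x y bx bY.
have seg t : 0 <= t <= 1 -> ball x0 r (segment_curve x y t).
  exact: segment_in_ball.
have cc t : 0 <= t <= 1 -> chart_cod c (segment_curve x y t).
  by move=> /seg /rP[].
split=> //; have C1 := C1_segment x y.
have dE t : derive1 (segment_curve x y) t = y - x.
  by rewrite derive1E; case: (is_derive_segment x y t).
have yx i : `|(y - x) 0 i| <= D.
  apply: le_trans (coord_norm_le _ _) _.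
  rewrite -(subrKA x0); apply: le_trans (ler_normD _ _) _.
  move: bx bY; rewrite -!ball_normE /= distrC => bx bY.
  by rewrite lerD // ltW // distrC.
rewrite arc_lengthE.
apply: (@le_trans _ _ (Rintegral mu `[0, 1]%classic
    (fun=> Num.sqrt (\sum_i \sum_j D * B i j * D)))).
  apply: le_Rintegral => //.
  - by apply: integrable01; exact: speed_within.
  - by apply: integrable01 => t; exact: cst_continuous.
  - move=> t /in01E t01; apply: ler_wsqrtr; rewrite quadE.
    apply: ler_sum => i _; apply: ler_sum => j _; rewrite dE.
    apply: le_trans (ler_norm _) _; rewrite !normrM.
    have B0 : `|metric c (segment_curve x y t) i j| <= B i j.
      by apply: ltW; have [_ /(_ (i, j))] := rP _ (seg t t01).
    by rewrite !ler_pM // mulr_ge0.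
have mu01 : mu `[0, 1]%classic = 1%E.
  have := @lebesgue_measure_itv R `[0, 1]; rewrite /= lte_fin ltr01 => ->.
  by rewrite sube0.
by rewrite Rintegral_cst // (_ : fine _ = 1) ?mulr1 // [X in fine X]mu01.
Unshelve. all: by end_near. Qed.

(** A coordinate segment, run in either direction, is put in front of a given path. The first clause
    bounds the added length uniformly in [p], for use with compactness; the second makes the set of
    points not joined to [q] open. *)
Lemma joined_locally p0 : exists C : R, \forall p \near p0,
  (forall q l, joined p0 q l -> exists2 l', l' <= C + l & joined p q l') /\
  (forall q l, joined p q l -> exists l', joined p0 q l').
Proof.
have [ac cp0] := chart_atP p0; set c := chart_at p0 in ac cp0.
have [r [C [r0 rP]]] := metric_local_bound ac (coord_cod cp0).
exists C.
have cc : {for p0, continuous (coord c)} by exact: Defs.coord_continuous.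
have : \forall p \near p0, chart_dom c p /\ ball (coord c p0) r (coord c p).
  apply: filterI.
    by apply: open_nbhs_nbhs; split => //; exact: chart_dom_open.
  by apply: cc; exact: nbhsx_ballx.
apply: filterS => p [cp bp]; have b0 := ballxx (coord c p0) r0.
have step p1 p2 q l : chart_dom c p1 -> chart_dom c p2 ->
    ball (coord c p0) r (coord c p1) -> ball (coord c p0) r (coord c p2) ->
    joined p2 q l -> exists2 l', l' <= C + l & joined p1 q l'.
  move=> c1 c2 b1 b2 j2; have [sc sC] := rP _ _ b1 b2.
  have := @joined_arc R n M c (segment_curve (coord c p1) (coord c p2)) q l ac
    (C1_segment _ _) sc.
  rewrite segment_curve1 segment_curve0 !coordK // => /(_ j2) j1.
  by exists (arc_length c (segment_curve (coord c p1) (coord c p2)) + l) => //;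
    rewrite lerD2r.
split=> q l; first by apply: step.
by move=> /(step p0 p q l cp0 cp b0 bp)[l' _ j]; exists l'.
Qed.

(** The points joined to [q] form an open and closed set. Nonemptiness of the set of lengths is what
    makes lower bounds pass to its infimum [rdist]. *)
Lemma joined_exists p q : connected [set: M] -> exists l, joined p q l.
Proof.
move=> cM; pose B := [set p | exists l, joined p q l].
suff : B = setT by move=> BT; have : B p by rewrite BT.
have oB : open B.
  rewrite openE => p0 [l jl]; have [C] := joined_locally p0.
  by apply: filterS => p' [/(_ _ _ jl)[l' _ j'] _]; exists l'.
have oCB : open (~` B).
  rewrite openE => p0 nB; have [C] := joined_locally p0.
  by apply: filterS => p' [_ back] [l jl]; apply: nB; exact: back jl.
apply: cM.
- by exists q, 0; exact: joined_refl.
- by exists B => //; rewrite setTI.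
- by exists B; rewrite ?setTI // -[B]setCK; exact: open_closedC.
Qed.

(** Compactness makes the local constants uniform. The bound ensures that the supremum in [inradius]
    is taken over a bounded set. *)
Lemma joined_bounded q : closed_manifold M ->
  exists k : R, forall p, exists2 l, l <= k & joined p q l.
Proof.
move=> [cM conM].
have /(_ R +oo (fun k p => exists2 l, l <= k & joined p q l) _) cov :=
  (compact_near_coveringP [set: M]).1 cM.
have [p0 _|k [_ kP]] := cov _.
  have [l jl] := joined_exists p0 q conM; have [C nC] := joined_locally p0.
  (* The path from [p0], of length [l], serves all nearby points at an extra cost of at most [C];
     larger values of [k] are also admissible. *)
  exists ([set p | exists2 l', l' <= C + l & joined p q l'],
          [set k | C + l <= k]).
    split => /=.
      by apply: filterS nC => p [/(_ _ _ jl)].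
    by apply: nbhs_pinfty_ge; exact: num_real.
  by move=> [p k] /= [[l' l'C j'] Ck]; exists l' => //; exact: le_trans Ck.
(* The neighbourhood of infinity only provides bounds strictly above [k]. *)
by exists (k + 1) => p; apply: kP => //; rewrite ltrDl.
Qed.

Lemma rdist_le p q l : joined p q l -> rdist p q <= l.
Proof.
by move=> j; apply: ge_inf => //; exists 0 => l'; exact: joined_ge0.
Qed.

Lemma rdist_ge p q (s : R) : connected [set: M] ->
  (forall l, joined p q l -> s <= l) -> s <= rdist p q.
Proof.
by move=> cM js; apply: lb_le_inf => //; exact: (joined_exists p q cM).
Qed.

Lemma rdist_set_ge p S (s : R) : connected [set: M] -> S !=set0 ->
  (forall q, S q -> forall l, joined p q l -> s <= l) -> s <= rdist_set p S.
Proof.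
move=> cM [q0 Sq0] js; apply: lb_le_inf; first by exists (rdist p q0), q0.
by move=> _ [q Sq <-]; apply: rdist_ge => //; exact: js.
Qed.

Lemma rdist_set_bounded S : closed_manifold M -> S !=set0 ->
  exists k : R, forall p, rdist_set p S <= k.
Proof.
move=> Mc [q Sq]; have [k kP] := joined_bounded q Mc; exists k => p.
have [l lk jl] := kP p; apply: le_trans (le_trans (rdist_le jl) lk).
apply: ge_inf; last by exists q.
exists 0 => _ [q' _ <-]; apply: rdist_ge; first by case: Mc.
by move=> l'; exact: joined_ge0.
Qed.

Lemma inradius_ge (v : M -> R) (D : set M) p : closed_manifold M ->
  nodal_set v !=set0 -> D p -> rdist_set p (nodal_set v) <= inradius v D.
Proof.
move=> Mc Z0 Dp; have [k kP] := rdist_set_bounded Mc Z0.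
apply: sup_upper_bound; last by exists p.
split; first by exists (rdist_set p (nodal_set v)), p.
by exists k => _ [q _ <-]; exact: kP.
Qed.

End Distance.

(** * Eigenfunctions *)

Section Eigenfunctions.
Context {R : realType} {n : nat} (M : riemannian_manifold R n).
Implicit Types (v : M -> R) (p q : M).
Local Notation metric := (@rm_metric R n M).

Lemma laplacianZ (U : set 'rV[R]_n) (G : 'rV[R]_n -> 'M[R]_n) (tau : R) f x :
  open U -> U x -> smooth_on U f ->
  laplacian G (fun y => tau * f y) x = tau * laplacian G f x.
Proof.
move=> oU Ux sf.
have pZ (u : 'rV[R]_n -> R) i y : smooth_on U u -> U y ->
    partial i (fun y => tau * u y) y = tau * partial i u y.
  move=> su Uy; have du : derivable u y 'e_i := smooth_on_derivable su Uy.
  rewrite [LHS](partialM (derivable_cst tau _ _) du) [partial _ _ _]derive_cst.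
  by rewrite mul0r add0r.
rewrite /laplacian mulr_sumr; apply: eq_bigr => i _.
rewrite mulr_sumr; apply: eq_bigr => j _; rewrite mulrCA; congr (_ * _).
rewrite !mxE mulrBr; congr (_ - _).
  rewrite (partial_congr i oU Ux (fun y => pZ f j y sf)) pZ //.
  exact: smooth_on_partial.
rewrite mulr_sumr; apply: eq_bigr => k _; rewrite pZ // mulrCA.
by [].
Qed.

Lemma eigenfunctionZ (lam tau : R) v : tau != 0 -> eigenfunction lam v ->
  eigenfunction lam (fun p => tau * v p).
Proof.
move=> tau0 [sv [p vp] lv]; split.
- move=> c ac; apply: smooth_onM; first exact: chart_cod_open.
    exact: smooth_on_cst.
  exact: sv.
- by exists p; rewrite mulf_neq0.
- move=> c x ac cx.
  rewrite (laplacianZ _ _ (@chart_cod_open _ _ _ c) cx (sv c ac)) lv //.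
  by rewrite mulrCA.
Qed.

Lemma eigenfunction_at_max (lam : R) v p : eigenfunction lam v ->
  (forall q, v q <= v p) -> 0 <= lam * v p.
Proof.
move=> [sv _ lv] vp; have [ac cp] := chart_atP p.
have cx := coord_cod cp; have E := coordK cp.
have := laplacian_at_max ac cx sv; rewrite lv // E => /(_ vp).
by rewrite mulNr oppr_le0.
Qed.

Lemma eigenfunction_normalized (lam : R) v : closed_manifold M ->
  eigenfunction lam v -> exists p, v p != 0 /\ forall q, `|v q| <= `|v p|.
Proof.
move=> Mc [sv [p0 vp0] _].
have cv : continuous (fun q => `|v q|).
  move=> q; apply: (@continuous_comp _ _ _ v (fun x : R => `|x|)).
    exact: smooth_function_continuous.
  exact: norm_continuous.
have [p pP] := closed_EVT_max p0 Mc cv; exists p; split=> //.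
by rewrite -normr_gt0 (lt_le_trans _ (pP p0)) // normr_gt0.
Qed.

(** Dividing [v] by its value where |v| is largest gives an eigenfunction with maximum 1; a
    nonpositive Laplacian there says that the eigenvalue is nonnegative. *)
Lemma first_eigenvalue_gt0 (lam : R) v : closed_manifold M ->
  eigenfunction lam v -> lam != 0 -> 0 < lam.
Proof.
move=> Mc ev lam0; have [p [vp0 vp]] := eigenfunction_normalized Mc ev.
have tau0 : (v p)^-1 != 0 by rewrite invr_eq0.
have := eigenfunction_at_max (eigenfunctionZ tau0 ev) (p := p).
rewrite mulVf // mulr1 lt_neqAle eq_sym lam0; apply=> q.
apply: le_trans (ler_norm _) _; rewrite normrM normfV.
by rewrite ler_pdivrMl ?normr_gt0 // mulr1.
Qed.

(** In dimension 0 the Laplacian is an empty sum. The conclusion is what makes (n-1)kappa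
    nonpositive. *)
Lemma eigenfunction_dim_gt0 (lam : R) v : eigenfunction lam v -> lam != 0 ->
  (0 < n)%N.
Proof.
move=> [_ [p vp] lv] lam0; rewrite lt0n; apply/eqP => n0.
have [ac cp] := chart_atP p; have := lv _ _ ac (coord_cod cp).
rewrite coordK // /laplacian big1 => [/esym/eqP|i _].
  by rewrite mulf_eq0 oppr_eq0 (negbTE lam0) (negbTE vp).
by have := ltn_ord i; rewrite [X in (_ < X)%N]n0 ltn0.
Qed.

(** The sign of the Laplacian gives a nonnegative maximum and a nonpositive minimum, and
    connectedness a zero between them. *)
Lemma nodal_set_nonempty (lam : R) v : closed_manifold M ->
  eigenfunction lam v -> 0 < lam -> nodal_set v !=set0.
Proof.
move=> Mc ev lam0; have [sv [p0 _] _] := ev.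
have cv := smooth_function_continuous sv.
have [p pP] := closed_EVT_max p0 Mc cv.
have [q qP] : exists q, forall r, v q <= v r.
  have cNv : continuous (fun r => - v r) by move=> r; exact: (continuousN (cv r)).
  have [q qP] := closed_EVT_max p0 Mc cNv.
  by exists q => r; rewrite -lerN2.
have vp : 0 <= v p by have := eigenfunction_at_max ev pP; rewrite pmulr_rge0.
have vq : v q <= 0.
  have N1 : -1 != 0 :> R by rewrite oppr_eq0 oner_eq0.
  have := @eigenfunction_at_max lam _ q (eigenfunctionZ N1 ev).
  by rewrite mulN1r pmulr_rge0 // oppr_ge0; apply=> r; rewrite !mulN1r lerN2.
have cI : connected (v @` [set: M]).
  by apply: connected_continuous_connected; [exact: Mc.2|exact: continuous_subspaceT].
have [r _ vr] : (v @` [set: M]) 0.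
  apply: ((connected_intervalP _).1 cI (v q) (v p)); [by exists q|by exists p|].
  by rewrite vq vp.
by exists r.
Qed.

Theorem largest_interior_diameter_ge (K lam a m s0 : R) v :
  closed_manifold M -> ricci_ge M K -> eigenfunction lam v -> 0 < lam ->
  0 <= a -> a < m -> K = - 2 * a ^+ 2 -> lam = m ^+ 2 - a ^+ 2 ->
  0 < s0 < model_radius m -> 2 * s0 <= largest_interior_diameter v.
Proof.
move=> Mc ricK ev lam_gt0 a0 am KE lamE /andP[s0_gt0 s0L].
have [p [vp0 vp]] := eigenfunction_normalized Mc ev.
have s0n : `|s0| < model_radius m by rewrite gtr0_norm.
have w0 : 0 < model a m s0.
  rewrite -(model0 a m); apply: (model_lt a0 am) => //.
  by rewrite normr0 (lt_trans s0_gt0).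
(* [tau] has the sign of [v p], so the scaled function takes the value w(s0) > 0 at [p] even when
   [v p] is negative. Scaling preserves the zeros. *)
pose tau := model a m s0 / v p.
have tau0 : tau != 0 by rewrite mulf_neq0 ?invr_eq0 // gt_eqF.
pose u q := tau * v q; have eu : eigenfunction lam u := eigenfunctionZ tau0 ev.
(* All values lie between -w(s0) and w(s0), inside the range on which w' is positive. *)
have uJ q : model_range a m (u q).
  have [s ss sE] : exists2 s, `|s| <= s0 & model a m s = u q.
    apply: (model_surj a0 am); first by rewrite s0L ltW.
    rewrite normrM normrM normfV (gtr0_norm w0) -mulrA ger_pMr //.
    by rewrite ler_pdivrMl ?normr_gt0 // mulr1.
  by exists s => //; exact: le_lt_trans ss s0L.
have K0 : K <= 0 by rewrite KE mulNr oppr_le0 mulr_ge0 // sqr_ge0.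
have ric_ge w : model_range a m w ->
    0 <= barrier1 a m w ^+ 2 / 4 - barrier a m w * barrier2 a m w / 2
         + (K - lam) * barrier a m w + lam * w * barrier1 a m w / 2.
  by move=> Jw; rewrite KE lamE; exact: barrier_riccati.
have phi_gt0 w : model_range a m w -> 0 < barrier a m w.
  by move=> Jw; rewrite /barrier exprn_gt0 // (slope_gt0 a0 am).
have est := gradient_estimate K0 lam_gt0 (is_derive_barrier a0 am)
  (is_derive_barrier1 a0 am) (barrier2_continuous a0 am) phi_gt0
  (barrier1_le0 a0 am) ric_ge Mc ricK eu uJ.
have crho w : model_range a m w -> {for w, continuous (slope a m)}.
  move=> Jw; apply: (@continuous_comp _ _ _ (model_inv a m) (model1 a m)).
    apply/differentiable_continuous/derivable1_diffP.
    by case: (is_derive_model_inv a0 am Jw).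
  apply/differentiable_continuous/derivable1_diffP.
  by case: (is_derive_model1 a m (model_inv a m w)).
have [su _ _] := eu.
have lip := joined_lipschitz (slope_gt0 a0 am) (is_derive_model_inv a0 am) crho
  su uJ est.
have up : u p = model a m s0 by rewrite /u /tau divfK.
have Z0 := nodal_set_nonempty Mc ev lam_gt0.
have dist_ge : s0 <= rdist_set p (nodal_set v).
  apply: (rdist_set_ge Mc.2 Z0) => q vq l /lip.
  rewrite up /u vq mulr0 (model_invK a0 am) //.
  rewrite -[X in model_inv a m X](model0 a m) (model_invK a0 am).
    by rewrite subr0 gtr0_norm.
  by rewrite normr0 (lt_trans s0_gt0).
rewrite /largest_interior_diameter le_max.
(* The sign of [v p] tells which nodal domain contains [p], and the larger inradius is at least the
   one of that domain. *)
have [vp_pos|vp_neg|vpE] := ltgtP 0 (v p).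
- rewrite ler_pM2l // (le_trans dist_ge) //.
  exact: (inradius_ge (D := nodal_pos v)).
- rewrite orbC ler_pM2l // (le_trans dist_ge) //.
  exact: (inradius_ge (D := nodal_neg v)).
- by rewrite -vpE eqxx in vp0.
Qed.

End Eigenfunctions.

(** * From the diameter bound to the two eigenvalue inequalities *)

Theorem theorem1 (R : realType) (n : nat) (M : riemannian_manifold R n)
    (kappa lambda : R) (v : M -> R)
    (Mclosed : closed_manifold M)
    (kappa_lt0 : kappa < 0)
    (Ric_ge : ricci_ge M ((n%:R - 1) * kappa))
    (lambda_first : first_nonzero_eigenvalue M lambda)
    (v_eigen : eigenfunction lambda v) :
  (1 / (1 - (n%:R - 1) * kappa / (2 * lambda))
     * (pi ^+ 2 / largest_interior_diameter v ^+ 2) <= lambda /\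
   0 < 1 / (1 - (n%:R - 1) * kappa / (2 * lambda))
         * (pi ^+ 2 / largest_interior_diameter v ^+ 2)) /\
  2^-1 * ((n%:R - 1) * kappa) + pi ^+ 2 / largest_interior_diameter v ^+ 2
    <= lambda.
Proof.
have [_ lam0 _] := lambda_first.
have lam_gt0 := first_eigenvalue_gt0 Mclosed v_eigen lam0.
have n_gt0 := eigenfunction_dim_gt0 v_eigen lam0.
pose K : R := (n%:R - 1) * kappa; rewrite -/K in Ric_ge *.
have K0 : K <= 0 by rewrite /K nmulr_lle0 // subr_ge0 ler1n.
(* In dimension 1, [K] and [a] vanish and the model degenerates to a sine. *)
pose a := Num.sqrt (- K / 2); pose m := Num.sqrt (lambda - K / 2).
have a2 : a ^+ 2 = - K / 2 by rewrite sqr_sqrtr //; lra.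
have m2 : m ^+ 2 = lambda - K / 2 by rewrite sqr_sqrtr //; lra.
have a0 : 0 <= a by exact: sqrtr_ge0.
have am : a < m by rewrite ltr_sqrt; lra.
have m0 : 0 < m by exact: le_lt_trans am.
set d := largest_interior_diameter v.
have dge s : 0 < s < model_radius m -> 2 * s <= d.
  apply: (largest_interior_diameter_ge Mclosed Ric_ge v_eigen lam_gt0 a0 am).
    by rewrite a2; field.
  by rewrite a2 m2; field.
have L0 : 0 < model_radius m by rewrite divr_gt0 ?pi_gt0 // mulr_gt0.
have d_ge : 2 * model_radius m <= d.
  rewrite leNgt; apply/negP => dL.
  (* Positivity of [d], from half the model radius, makes the midpoint of [d / 2] and the model
     radius an admissible [s], and twice that midpoint exceeds [d]. *)
  have d0 : 0 < d.
    apply: lt_le_trans (dge (model_radius m / 2) _); first by rewrite mulr_gt0 // divr_gt0.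
    by rewrite divr_gt0 //= ltr_pdivrMr // ltr_pMr // ltr1n.
  have := dge ((d / 2 + model_radius m) / 2); lra.
have mL : 2 * model_radius m = pi / m.
  by rewrite /model_radius; field; rewrite gt_eqF.
rewrite mL in d_ge; have pm0 : 0 < pi / m :> R by rewrite divr_gt0 ?pi_gt0.
have d0 : 0 < d := lt_le_trans pm0 d_ge.
have key : pi ^+ 2 / d ^+ 2 <= lambda - K / 2.
  rewrite ler_pdivrMr ?exprn_gt0 // -m2 -exprMn.
  have md : pi <= m * d by rewrite mulrC -ler_pdivrMr.
  by apply: lerXn2r; rewrite ?nnegrE ?pi_ge0 // (le_trans _ md) ?pi_ge0.
have q0 : 0 < pi ^+ 2 / d ^+ 2 by rewrite divr_gt0 ?exprn_gt0 ?pi_gt0.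
(* With this form of the prefactor, the first inequality is [key] multiplied by a positive
   constant. *)
have fE : 1 / (1 - K / (2 * lambda)) = lambda / (lambda - K / 2).
  by field; apply/andP; split; lra.
have D0 : 0 < lambda - K / 2 by lra.
split; last by lra.
rewrite fE; split; last by rewrite mulr_gt0 // divr_gt0.
by rewrite mulrAC ler_pdivrMr // ler_pM2l.
Qed.
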